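(* Let $(X,\|\cdot\|_X)$ and $(Y,\|\cdot\|_Y)$ be real Banach spaces and let $f:X\to Y$ be a locally Lipschitz map with a pseudo-Jacobian mapping $Jf$ satisfying the chain rule condition on $X$. Suppose that $Jf$ is regular at every $x\in X$ and that there is a positive lower semicontinuous function $m$ on $[0,\infty)$ with $\int_0^\infty m(\rho)\,d\rho=\infty$ such that $\mathrm{Reg}\,Jf(x)\ge m(\|x\|_X)$ for all $x\in X$. Then $f$ is a norm-coercive global homeomorphism from $X$ onto $Y$, the inverse $f^{-1}$ is Lipschitz on bounded subsets of $Y$, and for every $y\in Y$ $$\mathrm{Lip}\,f^{-1}(y)\le\bigl(m(\|f^{-1}(y)\|_X)\bigr)^{-1}.$$
   Context: Notation: $B(x;r)$ is the open ball of center $x$ and radius $r$; $L(X,Y)$ is the space of bounded linear operators from $X$ to $Y$ with the operator norm; $X^*=L(X,\mathbb R)$; $\mathrm{co}$ is the convex hull and $\overline{\mathrm{co}}$ the closed convex hull (closure in operator norm). Pseudo-Jacobian: for $\phi:X\to\mathbb R$, $\phi'_+(x;v)=\limsup_{t\to0^+}\frac{\phi(x+tv)-\phi(x)}{t}$. For a continuous map $f:X\to Y$, a nonempty set $Jf(x)\subset L(X,Y)$ is a pseudo-Jacobian of $f$ at $x$ if for every $y^*\in Y^*$ and $v\in X$, $(y^*\circ f)'_+(x;v)\le\sup\{\langle y^*,T(v)\rangle: T\in Jf(x)\}$. A pseudo-Jacobian mapping for $f$ on $X$ (also just called a pseudo-Jacobian $Jf$) is a set-valued map $Jf:X\to2^{L(X,Y)}$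 such that $Jf(x)$ is a pseudo-Jacobian of $f$ at $x$ for every $x\in X$. The same definition with $Y=\mathbb R$ applies to real-valued functions. Write $Jf(A)=\bigcup_{z\in A}Jf(z)$. Chain rule condition: for $y\in Y$ let $F_y(x)=\|f(x)-y\|_Y$. For $x\in X$ and $y\ne f(x)$ let $$\Delta F_y(x)=\partial\|\cdot\|_Y(f(x)-y)\circ\overline{\mathrm{co}}(Jf(x))=\{y^*\circ T:\ y^*\in\partial\|\cdot\|_Y(f(x)-y),\ T\in\overline{\mathrm{co}}(Jf(x))\}\subset X^*,$$ where $\partial\|\cdot\|_Y(z)$ is the (Clarke, equivalently convex) subdifferential of the norm of $Y$ at $z$. $Jf$ satisfies the chain rule condition on $X$ if for each $x\in X$ and each $y\neq f(x)$ the set $\Delta F_y(x)$ is $w^*$-closed and convex in $X^*$ and is a pseudo-Jacobian of $F_y$ at $x$. Regularity: for $T\in L(X,Y)$ let $C(T)=\inf_{\|v^*\|_{Y^*}=1}\|T^*v^*\|_{X^*}$ and $C^*(T)=\inf_{\|u\|_X=1}\|Tu\|_Y$. (If $T$ is an isomorphism, $C(T)=C^*(T)=\|T^{-1}\|^{-1}$.) Define $$\mathrm{Sur}\,Jf(x)=\sup_{r>0}\inf\{C(T): T\in\mathrm{co}\,Jf(B(x;r))\},\qquad \mathrm{Inj}\,Jf(x)=\sup_{r>0}\inf\{C^*(T): T\in\mathrm{co}\,Jf(B(x;r))\}.$$ $Jf$ is regular at $x_0$ if, for some $r>0$, every $T\in\mathrm{co}\,Jf(B(x_0;r))$ is an isomorphism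 from $X$ onto $Y$ and $\mathrm{Reg}\,Jf(x_0)>0$, where $\mathrm{Reg}\,Jf(x_0):=\mathrm{Sur}\,Jf(x_0)=\mathrm{Inj}\,Jf(x_0)$ is the regularity index (the two quantities coincide when the operators in $\mathrm{co}\,Jf(B(x_0;r))$ are isomorphisms). Locally Lipschitz: every point has a neighborhood on which the map is Lipschitz. For a map $g$ between Banach spaces, the local Lipschitz constant at $x$ is $\mathrm{Lip}\,g(x)=\inf_{r>0}\sup\left\{\frac{\|g(u)-g(w)\|}{\|u-w\|}: u,w\in B(x;r),\ u\ne w\right\}$. Norm-coercive: $\lim_{\|x\|_X\to\infty}\|f(x)\|_Y=\infty$. *)

(* Defs.v *)
From HB Require Import structures.
From mathcomp Require Import all_boot all_order all_algebra.
From mathcomp Require Import all_classical all_reals all_analysis.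

Set Implicit Arguments.
Unset Strict Implicit.
Unset Printing Implicit Defensive.

Import Order.TTheory GRing.Theory Num.Theory.
Import numFieldNormedType.Exports.

Local Open Scope classical_set_scope.
Local Open Scope ring_scope.

(* for linear maps between normed spaces, continuous means bounded *)
Definition bounded_linear (R : realType) (X Y : normedModType R) :
  {pred X -> Y} := mem [set T : X -> Y | linear T /\ continuous T].

Record blin (R : realType) (X Y : normedModType R) := BLin {
  blin_fun :> X -> Y ;
  blinP : blin_fun \in @bounded_linear R X Y }.

Section blin_lmodule.
Context (R : realType) (X Y : normedModType R).

HB.instance Definition _ := [isSub for @blin_fun R X Y].
HB.instance Definition _ := [Choice of blin X Y by <:].

Lemma blin_linear (T : blin X Y) : linear T.
Proof. by have := blinP T; rewrite inE => -[]. Qed.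

Lemma blin_continuous (T : blin X Y) : continuous T.
Proof. by have := blinP T; rewrite inE => -[]. Qed.

HB.instance Definition _ (T : blin X Y) :=
  GRing.isLinear.Build R X Y *:%R (T : X -> Y) (blin_linear T).

Lemma bounded_linear_submod_closed :
  submod_closed (@bounded_linear R X Y).
Proof.
split.
  rewrite inE; split; first by move=> a u v; rewrite scaler0 addr0.
  exact: cst_continuous.
move=> a S T; rewrite !inE => -[linS contS] [linT contT]; split.
  move=> b u v.
  have E z : (a *: S + T) z = a *: S z + T z by [].
  by rewrite !E linS linT !scalerDr !scalerA (mulrC b) addrACA.
by move=> x; apply: cvgD; [apply: cvgZr; exact: contS | exact: contT].
Qed.

HB.instance Definition _ := GRing.isSubmodClosed.Build R (X -> Y)
  (@bounded_linear R X Y) bounded_linear_submod_closed.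
HB.instance Definition _ := [SubChoice_isSubLmodule of blin X Y by <:].

End blin_lmodule.

Section operator_norm.
Context (R : realType) (X Y : normedModType R).
Implicit Types S T : blin X Y.

Definition opnorm T : R := sup [set `|T x| | x in [set x | `|x| <= 1]].

Let opnorm_has_sup T : has_sup [set `|T x| | x in [set x | `|x| <= 1]].
Proof.
split; first by exists `|T 0|, 0 => //=; rewrite normr0 ler01.
have /linear_bounded_continuous/bounded_funP/(_ 1)[M TM] :=
  @blin_continuous _ _ _ T.
by exists M => _ [x /= x1 <-]; exact: TM.
Qed.

Lemma opnorm_ge0 T : 0 <= opnorm T.
Proof.
apply: (le_trans (normr_ge0 (T 0))); apply: sup_upper_bound => //.
by exists 0 => //=; rewrite normr0 ler01.
Qed.

Lemma le_opnorm T x : `|T x| <= opnorm T * `|x|.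
Proof.
have [->|x0] := eqVneq x 0; first by rewrite linear0 !normr0 mulr0.
have nx0 : 0 < `|x| by rewrite normr_gt0.
rewrite -ler_pdivrMr// mulrC.
have -> : `|x|^-1 * `|T x| = `|T (`|x|^-1 *: x)|.
  by rewrite linearZ/= normrZ gtr0_norm// invr_gt0.
apply: sup_upper_bound => //; exists (`|x|^-1 *: x) => //=.
by rewrite normrZ gtr0_norm ?invr_gt0// mulVf// gt_eqF.
Qed.

Lemma opnorm_le T M : 0 <= M -> (forall x, `|T x| <= M * `|x|) -> opnorm T <= M.
Proof.
move=> M0 TM; apply: ge_sup; first by have [] := opnorm_has_sup T.
move=> _ [x /= x1 <-]; apply: (le_trans (TM x)).
by rewrite -[leRHS]mulr1 ler_wpM2l.
Qed.

Let ler_opnormD S T : opnorm (S + T) <= opnorm S + opnorm T.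
Proof.
apply: opnorm_le; first by rewrite addr_ge0// opnorm_ge0.
move=> x; rewrite mulrDl; apply: le_trans (ler_normD _ _) _.
by rewrite lerD// le_opnorm.
Qed.

Let opnormZ_le (a : R) T : opnorm (a *: T) <= `|a| * opnorm T.
Proof.
apply: opnorm_le; first by rewrite mulr_ge0// opnorm_ge0.
by move=> x; rewrite [leLHS]normrZ -mulrA ler_wpM2l// le_opnorm.
Qed.

Let opnormZ (a : R) T : opnorm (a *: T) = `|a| * opnorm T.
Proof.
apply/le_anti; rewrite opnormZ_le/=.
have [->|a0] := eqVneq a 0; first by rewrite normr0 mul0r opnorm_ge0.
have {1}-> : T = a^-1 *: (a *: T) by rewrite scalerA mulVf// scale1r.
rewrite mulrC -ler_pdivlMr ?normr_gt0//.
by rewrite mulrC -normfV opnormZ_le.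
Qed.

Let opnorm0_eq0 T : opnorm T = 0 -> T = 0.
Proof.
move=> T0; apply/val_inj/funext => x /=; apply/normr0_eq0/le_anti.
by rewrite normr_ge0 andbT (le_trans (le_opnorm T x))// T0 mul0r.
Qed.

HB.instance Definition _ := Lmodule_isNormed.Build R (blin X Y)
  ler_opnormD opnormZ opnorm0_eq0.

End operator_norm.

Notation dual R X := (@blin R X R^o).

Section composition.
Context (R : realType) (X Y Z : normedModType R).

Let blin_comp_subproof (S : blin Y Z) (T : blin X Y) :
  (S \o T) \in @bounded_linear R X Z.
Proof.
rewrite inE; split; first by move=> a u v /=; rewrite !linearP.
by move=> x; apply: continuous_comp; exact: blin_continuous.
Qed.

Definition blin_comp S T : blin X Z := BLin (blin_comp_subproof S T).

End composition.

Section pseudo_jacobian.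
Context (R : realType) (X Y : normedModType R).

(* upper right-hand Dini directional derivative, with values in the extended
   reals *)
Definition dini_upper (phi : X -> R) (x v : X) : \bar R :=
  limf_esup (fun t : R => ((phi (x + t *: v) - phi x) / t)%:E) 0^'+.

Definition pseudo_jacobian_at (f : X -> Y) (x : X) (J : set (blin X Y)) :=
  J !=set0 /\
  forall (l : dual R Y) (v : X),
    (dini_upper (l \o f) x v <= ereal_sup [set (l (T v))%:E | T in J])%E.

Definition pseudo_jacobian (f : X -> Y) (Jf : X -> set (blin X Y)) :=
  forall x, pseudo_jacobian_at f x (Jf x).

End pseudo_jacobian.

Definition convex_hull (R : realType) (V : normedModType R) (A : set V) :
  set V := smallest (@convex_set R V) A.

Definition closed_convex_hull (R : realType) (V : normedModType R)
  (A : set V) : set V := closure (convex_hull A).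

(* the weak-star topology is the one induced on the dual by the topology of
   pointwise convergence *)
Definition weak_star_closed (R : realType) (X : normedModType R)
    (A : set (dual R X)) :=
  closed (A : set (initial_topology
    ((fun l => l) : dual R X -> {ptws X -> R^o}))).

Definition norm_subdifferential (R : realType) (Y : normedModType R) (z : Y) :
  set (dual R Y) := [set l | forall w, l (w - z) <= `|w| - `|z|].

Section regularity.
Context (R : realType) (X Y : normedModType R).
Implicit Types (f : X -> Y) (Jf : X -> set (blin X Y)) (T : blin X Y).

Definition chain_rule_set f Jf (y : Y) (x : X) : set (dual R X) :=
  [set blin_comp l T | l in norm_subdifferential (f x - y)
                     & T in closed_convex_hull (Jf x)].

Definition chain_rule_condition f Jf :=
  forall x y, y <> f x ->
  [/\ weak_star_closed (chain_rule_set f Jf y x),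
      convex_set (chain_rule_set f Jf y x) &
      pseudo_jacobian_at ((fun z => `|f z - y|) : X -> R^o) x
        (chain_rule_set f Jf y x)].

(* the infima below are +oo when the unit sphere is empty *)
Definition surjectivity_modulus T : \bar R :=
  ereal_inf [set `|blin_comp l T|%:E | l in [set l : dual R Y | `|l| = 1]].

Definition injectivity_modulus T : \bar R :=
  ereal_inf [set `|T u|%:E | u in [set u : X | `|u| = 1]].

Definition co_image Jf (x : X) (r : R) : set (blin X Y) :=
  convex_hull (\bigcup_(z in ball x r) Jf z).

Definition sur_index Jf (x : X) : \bar R :=
  ereal_sup [set ereal_inf (surjectivity_modulus @` co_image Jf x r)
            | r in [set r : R | 0 < r]].

Definition inj_index Jf (x : X) : \bar R :=
  ereal_sup [set ereal_inf (injectivity_modulus @` co_image Jf x r)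
            | r in [set r : R | 0 < r]].

Definition isomorphism T :=
  exists S : blin Y X, cancel T S /\ cancel S T.

(* [sur_index] and [inj_index] agree at [x] as soon as all the operators of
   some [co_image Jf x r], [0 < r], are isomorphisms, since then both moduli
   of such a [T] equal the inverse of the norm of [T^-1]; the regularity index
   is their common value and is meaningful only in that situation *)
Definition reg_index Jf (x : X) : \bar R := sur_index Jf x.

Definition regular_at Jf (x : X) :=
  (exists2 r : R, 0 < r & forall T, co_image Jf x r T -> isomorphism T) /\
  (0 < reg_index Jf x)%E.

End regularity.

Section maps.
Context (R : realType) (V W : normedModType R).
Implicit Type g : V -> W.

(* [locally [lipschitz _ | _ in setT]] is not used because it bounds
   difference quotients near every pair of points rather than near points *)
Definition locally_lipschitz g :=
  forall x : V, exists2 U, nbhs x U & [lipschitz g z | z in U].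

Definition local_lipschitz_constant g (x : V) : \bar R :=
  ereal_inf
    [set ereal_sup [set (`|g p.1 - g p.2| / `|p.1 - p.2|)%:E
                   | p in [set p : V * V | [/\ ball x r p.1, ball x r p.2 &
                                              p.1 <> p.2]]]
    | r in [set r : R | 0 < r]].

Definition norm_coercive g :=
  forall M : R, exists r : R, forall x, r < `|x| -> M < `|g x|.

End maps.

(* Main.v *)
Require Import Defs.
From HB Require Import structures.
From mathcomp Require Import all_boot all_order all_algebra.
From mathcomp Require Import all_classical all_reals all_analysis.
From mathcomp Require Import measurable_realfun.
From mathcomp Require Import ring lra.

Set Implicit Arguments.
Unset Strict Implicit.
Unset Printing Implicit Defensive.

Import Order.TTheory GRing.Theory Num.Theory.
Import numFieldNormedType.Exports.

Local Open Scope classical_set_scope.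
Local Open Scope ring_scope.


(* Separation turns the lower bound on the surjectivity index into the local
   expansion c |u - w| <= |f u - f w|. Ekeland's principle for |f - y|, the chain
   rule condition and a w*-compactness argument make f open at the same rate c.
   Hence segments issued from f 0 can be lifted locally. Along a lift, a
   potential of a continuous minorant of m, evaluated at the norm of the lift,
   grows at most as fast as the segment; since the integral of m diverges the
   lift stays bounded and extends to the whole segment. Endpoints of the lifts
   define a continuous right inverse g of f, and g (f x) = x propagates from 0
   to x along the segment [0, x] by local injectivity. *)

(** * Sublinear functionals and the Hahn-Banach theorem *)

(** Two obstacles shape the argument. In infinite dimension an expanding map need not be open, so
    openness needs its own proof. For each direction the chain rule condition yields some functional
    of [chain_rule_set] that is not too negative there, whereas a contradiction requires one
    functional of small norm, hence good in all directions; this exchange of quantifiers is a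
    minimax argument resting on convexity and w*-closedness. The second obstacle is that [m] is only
    lower semicontinuous: its integral may be infinite on bounded intervals and provides no
    potential directly. Half the integral of a Lipschitz minorant has slope strictly below [m] near
    each point, and the minorant may be chosen after the bound [L] on the length of the segment, so
    that its potential exceeds [L] at some radius. Local constants are kept strictly below the
    regularity index; this margin pays for the closure of the convex hull. *)

Section sublinear.
Context (R : realType) (V : lmodType R).
Implicit Types (p q : V -> R) (C : set (V * R)).

Definition sublinear q :=
  (forall x y, q (x + y) <= q x + q y) /\
  (forall t x, 0 <= t -> q (t *: x) <= t * q x).

Lemma sublinear0 q : sublinear q -> q 0 = 0.
Proof.
move=> [qD qZ]; apply/le_anti/andP; split.
  by have := qZ 0 0 (lexx _); rewrite scale0r mul0r.
by have := qD 0 0; rewrite addr0; lra.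
Qed.

Lemma sublinear_geN q x : sublinear q -> - q (- x) <= q x.
Proof.
by move=> sq; have := sq.1 x (- x); rewrite subrr sublinear0//; lra.
Qed.

(* The largest sublinear functional below [q] lying under [- c.2] at [- c.1]
   for every [c] of the convex cone [C]. *)
Definition sublinear_below q C (y : V) : R :=
  inf [set q (y + c.1) - c.2 | c in C].

Section below.
Variables (q : V -> R) (C : set (V * R)).
Hypotheses (sq : sublinear q) (C0 : C 0).
Hypothesis CD : forall c d, C c -> C d -> C (c + d).
Hypothesis CZ : forall t c, 0 < t -> C c -> C (t *: c).
Hypothesis Cq : forall c, C c -> c.2 <= q c.1.

Let lb y : has_lbound [set q (y + c.1) - c.2 | c in C].
Proof.
exists (- q (- y)) => _ [c Cc <-].
by have := sq.1 (y + c.1) (- y); rewrite addrAC subrr add0r; have := Cq Cc; lra.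
Qed.

Let ne y : [set q (y + c.1) - c.2 | c in C] !=set0.
Proof. by exists (q (y + 0) - 0); exists 0. Qed.

Lemma sublinear_below_le y c : C c -> sublinear_below q C y <= q (y + c.1) - c.2.
Proof. by move=> Cc; apply: ge_inf => //; exists c. Qed.

Lemma sublinear_below_le0 y : sublinear_below q C y <= q y.
Proof. by have := sublinear_below_le y C0; rewrite addr0 subr0. Qed.

Lemma sublinear_below_sublinear : sublinear (sublinear_below q C).
Proof.
have lowP y M : (forall c, C c -> M <= q (y + c.1) - c.2) ->
    M <= sublinear_below q C y.
  by move=> H; apply: lb_le_inf => // _ [c Cc <-]; exact: H.
split=> [x y|t x].
  rewrite -lerBlDl; apply: (lowP) => d Cd; rewrite lerBlDr -lerBlDl.
  apply: (lowP) => c Cc; have := sublinear_below_le (x + y) (CD Cc Cd).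
  rewrite -[(c + d).1]/(c.1 + d.1) -[(c + d).2]/(c.2 + d.2).
  by rewrite (addrACA x y); have := sq.1 (x + c.1) (y + d.1); lra.
rewrite le_eqVlt => /predU1P[<-|t0].
  by rewrite scale0r mul0r -(sublinear0 sq) sublinear_below_le0.
rewrite mulrC -ler_pdivrMr//; apply: (lowP) => c Cc.
rewrite ler_pdivrMr// mulrC; have := sublinear_below_le (t *: x) (CZ t0 Cc).
rewrite -[(t *: c).1]/(t *: c.1) -[(t *: c).2]/(t * c.2) -scalerDr.
by have := sq.2 t (x + c.1) (ltW t0); lra.
Qed.

End below.

(** Zorn's lemma. The infimum of a chain is finite because every member is at least [- q (- x)] at
    [x], and it is subadditive because the smaller of two members serves both arguments. *)
Lemma minimal_sublinear q : sublinear q ->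
  exists p, [/\ sublinear p, forall x, p x <= q x &
    forall p', sublinear p' -> (forall x, p' x <= p x) -> p' =1 p].
Proof.
move=> sq.
pose T := {p : V -> R | sublinear p /\ forall x, p x <= q x}.
(* The order is reversed: maximal elements are minimal functionals. *)
pose below (p p' : T) := `[< forall x, sval p' x <= sval p x >].
have [//||||t tmin] := @Zorn T below.
- by move=> t; apply/asboolP.
- move=> r s t /asboolP rs /asboolP st; apply/asboolP => x.
  exact: le_trans (st x) (rs x).
- move=> [s Ps] [t Pt] /asboolP st /asboolP ts; apply: eq_exist.
  by apply/funext => x; apply/le_anti; rewrite st ts.
- move=> A totA; have [->|/set0P[a Aa]] := eqVneq A set0.
    by exists (exist _ q (conj sq (fun x => lexx _))).
  pose p x := inf [set sval s x | s in A].
  have lbA x : has_lbound [set sval s x | s in A].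
    exists (- q (- x)) => _ [s As <-].
    have [ss sle] := svalP s; have := sublinear_geN x ss.
    by have := sle (- x); lra.
  have leP s x : A s -> p x <= sval s x by move=> As; apply: ge_inf => //; exists s.
  have geP M x : (forall s, A s -> M <= sval s x) -> M <= p x.
    move=> H; apply: lb_le_inf; first by exists (sval a x), a.
    by move=> _ [s As <-]; exact: H.
  have sp : sublinear p.
    split=> [x y|t x].
      rewrite -lerBlDl; apply: (geP) => s As; rewrite lerBlDr -lerBlDl.
      apply: (geP) => s' As'.
      have [/asboolP ss'|/asboolP ss'] := totA _ _ As As'.
        have := leP _ (x + y) As'; have [[sD _] _] := svalP s'.
        by have := sD x y; have := ss' y; lra.
      have := leP _ (x + y) As; have [[sD _] _] := svalP s.
      by have := sD x y; have := ss' x; lra.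
    rewrite le_eqVlt => /predU1P[<-|t0].
      rewrite scale0r mul0r; apply: le_trans (leP _ _ Aa) _.
      by rewrite sublinear0//; have [] := svalP a.
    rewrite mulrC -ler_pdivrMr//; apply: (geP) => s As.
    rewrite ler_pdivrMr// mulrC; apply: le_trans (leP _ _ As) _.
    by have [[_ sZ] _] := svalP s; rewrite sZ// ltW.
  have pq x : p x <= q x.
    by apply: le_trans (leP _ _ Aa) _; have [_ ->] := svalP a.
  exists (exist _ p (conj sp pq)) => s As; apply/asboolP => x /=; exact: leP.
have [st tle] := svalP t; exists (sval t); split=> // p' sp' p'le.
have p'q x : p' x <= q x by exact: le_trans (p'le x) (tle x).
have /(congr1 sval) /= -> // : exist _ p' (conj sp' p'q) = t.
by apply: tmin; apply/asboolP.
Qed.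

(** A minimal [p] equals [sublinear_below p C] for the ray [C] through [(x, p x)], whence
    [p y <= p (y + x) - p x], the missing half of additivity. *)
Lemma minimal_sublinear_linear p : sublinear p ->
  (forall p', sublinear p' -> (forall x, p' x <= p x) -> p' =1 p) ->
  linear (p : V -> R^o).
Proof.
move=> sp pmin.
have padd x y : p (x + y) = p x + p y.
  pose C : set (V * R) := [set (t *: x, t * p x) | t in [set t | 0 <= t]].
  have C0 : C 0 by exists 0 => //=; rewrite scale0r mul0r.
  have CD c d : C c -> C d -> C (c + d).
    move=> [t /= t0 <-] [s /= s0 <-]; exists (t + s) => /=; first exact: addr_ge0.
    by rewrite scalerDl mulrDl.
  have CZ t c : 0 < t -> C c -> C (t *: c).
    move=> t0 [s /= s0 <-]; exists (t * s) => /=; first by rewrite mulr_ge0// ltW.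
    by rewrite -scalerA -mulrA.
  have Cp c : C c -> c.2 <= p c.1.
    move=> [t /= t0 <-] /=; move: t0; rewrite le_eqVlt => /predU1P[<-|t0].
      by rewrite mul0r scale0r sublinear0.
    have t0' : 0 <= t^-1 by rewrite invr_ge0 ltW.
    have := sp.2 t^-1 (t *: x) t0'.
    by rewrite scalerA mulVf ?gt_eqF// scale1r mulrC ler_pdivlMr// mulrC.
  have e := pmin _ (sublinear_below_sublinear sp C0 CD CZ Cp)
    (sublinear_below_le0 sp C0 Cp).
  have Cx : C (x, p x) by exists 1 => //=; rewrite scale1r mul1r.
  have := sublinear_below_le sp Cp y Cx; rewrite e /= (addrC y).
  by move: (sp.1 x y) => h1 h2; apply/eqP; rewrite eq_le h1/=; lra.
have pN x : p (- x) = - p x.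
  by have := padd x (- x); rewrite subrr (sublinear0 sp); lra.
have pZp t x : 0 < t -> p (t *: x) = t * p x.
  move=> t0; apply/le_anti; rewrite (sp.2 _ _ (ltW t0))/=.
  have t0' : 0 <= t^-1 by rewrite invr_ge0 ltW.
  have := sp.2 t^-1 (t *: x) t0'.
  by rewrite scalerA mulVf ?gt_eqF// scale1r mulrC ler_pdivlMr// mulrC.
move=> a x y; rewrite padd; congr (_ + _).
have [a0|a0|->] := ltgtP a 0.
- by rewrite -[a]opprK scaleNr pN pZp ?oppr_gt0// scaleNr.
- exact: pZp.
- by rewrite !scale0r (sublinear0 sp).
Qed.

(* Mazur-Orlicz form of the Hahn-Banach theorem. *)
Lemma mazur_orlicz q (A : set V) (d : R) : sublinear q -> A !=set0 ->
  (forall a b (t s : R), A a -> A b -> 0 <= t -> 0 <= s -> t + s = 1 ->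
     A (t *: a + s *: b)) ->
  (forall a, A a -> d <= q a) ->
  exists l : V -> R^o, [/\ linear l, forall x, l x <= q x &
    forall a, A a -> d <= l a].
Proof.
move=> sq [a0 Aa0] Aconv dq.
(* The cone over [A] at height [d]: a functional below [sublinear_below q C] is at most
   [q (- a + a) - d = - d] at [- a]. *)
pose C : set (V * R) := [set c | exists (t : R) a, [/\ 0 <= t, A a & c = (t *: a, t * d)]].
have C0 : C 0 by exists 0, a0; rewrite scale0r mul0r.
have CD c e : C c -> C e -> C (c + e).
  move=> [t [a [t0 Aa ->]]] [s [b [s0 Ab ->]]].
  have := addr_ge0 t0 s0; rewrite le_eqVlt => /predU1P[ts0|ts0].
    have -> : t = 0 by lra.
    have -> : s = 0 by lra.
    exists 0, a; split=> //.
    by rewrite !scale0r !mul0r; congr (_, _); rewrite /= addr0.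
  exists (t + s), ((t / (t + s)) *: a + (s / (t + s)) *: b); split.
  - exact: ltW.
  - by apply: Aconv => //; rewrite ?divr_ge0 ?(ltW ts0)// -mulrDl divff ?gt_eqF.
  - have E u : (t + s) * (u / (t + s)) = u by rewrite mulrC divfK ?gt_eqF.
    by rewrite scalerDr !scalerA !E mulrDl.
have CZ t c : 0 < t -> C c -> C (t *: c).
  move=> t0 [s [a [s0 Aa ->]]]; exists (t * s), a; split=> //.
    by rewrite mulr_ge0// ltW.
  by rewrite -scalerA -mulrA.
have Cq c : C c -> c.2 <= q c.1.
  move=> [t [a [+ Aa ->]]] /=; rewrite le_eqVlt => /predU1P[<-|t0].
    by rewrite mul0r scale0r sublinear0.
  have t0' : 0 <= t^-1 by rewrite invr_ge0 ltW.
  have := sq.2 t^-1 (t *: a) t0'.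
  rewrite scalerA mulVf ?gt_eqF// scale1r mulrC ler_pdivlMr// mulrC.
  by apply: le_trans; rewrite ler_wpM2l ?dq// ltW.
have [p [sp pq pmin]] := minimal_sublinear (sublinear_below_sublinear sq C0 CD CZ Cq).
have linp := minimal_sublinear_linear sp pmin.
exists p; split=> // [x|a Aa].
  exact: le_trans (pq x) (sublinear_below_le0 sq C0 Cq x).
have Ca : C (a, d) by exists 1, a; rewrite scale1r mul1r.
have := sublinear_below_le sq Cq (- a) Ca.
rewrite /= addNr (sublinear0 sq) => h; have := pq (- a).
have := linp (-1) a 0; rewrite addr0 scaleN1r (sublinear0 sp) addr0.
by rewrite scaleN1r => ->; lra.
Qed.

End sublinear.

Section hahn_banach.
Context (R : realType).

Lemma linear_bounded_continuous_le (X Y : normedModType R) (f : X -> Y) (M : R) :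
  linear f -> (forall x, `|f x| <= M * `|x|) -> continuous f.
Proof.
move=> linf fM x; apply/cvgrPdist_lt => e e0.
near=> z; have -> : f x - f z = f (x - z).
  by have := linf (-1) z x; rewrite !scaleN1r addrC => <-; rewrite addrC.
apply: (le_lt_trans (fM _)).
have M1 : 0 < `|M| + 1 by rewrite ltr_wpDl.
apply: (@le_lt_trans _ _ ((`|M| + 1) * `|x - z|)).
  by rewrite ler_wpM2r// ler_wpDr// ler_norm.
rewrite mulrC -ltr_pdivlMr//; near: z.
by apply: cvgr_dist_lt => //; rewrite divr_gt0.
Unshelve. all: end_near. Qed.

Lemma dual_of_linear (X : normedModType R) (f : X -> R^o) (M : R) :
  linear f -> 0 <= M -> (forall x, f x <= M * `|x|) ->
  exists2 l : dual R X, (forall x, l x = f x) & `|l| <= M.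
Proof.
move=> linf M0 fM.
have f0 : f 0 = 0.
  by have := linf (-1) 0 0; rewrite scaler0 addr0 scaleN1r addNr.
have fN x : f (- x) = - f x.
  by have := linf (-1) x 0; rewrite addr0 scaleN1r f0 addr0 scaleN1r.
have fM' x : `|f x| <= M * `|x|.
  by rewrite ler_norml fM andbT lerNl -fN (le_trans (fM _))// normrN.
have fP : f \in @bounded_linear R X R^o.
  by rewrite inE; split=> //; exact: linear_bounded_continuous_le fM'.
by exists (BLin fP) => //; apply: opnorm_le.
Qed.

Lemma norm_sublinear (X : normedModType R) : sublinear (fun x : X => `|x|).
Proof.
split=> [x y|t x t0]; first exact: ler_normD.
by rewrite normrZ ger0_norm.
Qed.

(** The Mazur-Orlicz theorem for the norm: for positive [d] it separates [A] from the open ball of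
    radius [d] about 0. *)
Lemma convex_norm_separation (X : normedModType R) (A : set X) (d : R) :
  A !=set0 ->
  (forall a b (t s : R), A a -> A b -> 0 <= t -> 0 <= s -> t + s = 1 ->
     A (t *: a + s *: b)) ->
  (forall a, A a -> d <= `|a|) ->
  exists2 l : dual R X, `|l| <= 1 & forall a, A a -> d <= l a.
Proof.
move=> A0 Ac Ad.
have [f [linf fle fA]] := mazur_orlicz (norm_sublinear X) A0 Ac Ad.
have [|l lE l1] := dual_of_linear linf ler01; first by move=> x; rewrite mul1r.
by exists l => // a Aa; rewrite lE fA.
Qed.

Lemma norming_functional (X : normedModType R) (x : X) :
  exists2 l : dual R X, `|l| <= 1 & l x = `|x|.
Proof.
have [|||l l1 lx] := @convex_norm_separation X [set x] `|x|.
- by exists x.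
- by move=> a b t s -> -> _ _ ts /=; rewrite -scalerDl ts scale1r.
- by move=> a ->.
exists l => //; apply/le_anti; rewrite lx// andbT (le_trans (ler_norm _))//.
by rewrite (le_trans (le_opnorm _ _))// -[leRHS]mul1r ler_wpM2r.
Qed.

End hahn_banach.

Lemma convex_setP (R : realType) (V : lmodType R) (A : set V) :
  convex_set A -> forall a b (t s : R), A a -> A b -> 0 <= t -> 0 <= s ->
  t + s = 1 -> A (t *: a + s *: b).
Proof.
move=> Ac a b t s Aa Ab t0 s0 ts.
have t1 : t <= 1 by lra.
have := Ac a b (Itv01 t0 t1) (mem_set Aa) (mem_set Ab).
have -> : s = 1 - t by lra.
by rewrite inE.
Qed.

(** * Weak-star compactness and functionals of small norm *)

Section weak_star.
Context (R : realType) (X : normedModType R).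
Implicit Types A : set (dual R X).

(* A functional separating the box with half-sides [c * `|x i| + e] from the
   image of [A] in R^n would contradict the lower bound on [A]. *)
Lemma convex_dual_finite_approx A (c e : R) n (x : 'I_n -> X) :
  convex_set A -> 0 <= c -> 0 < e ->
  (forall v e', 0 < e' -> exists2 l, A l & - (c * `|v|) - e' <= l v) ->
  exists2 l, A l & forall i, `|l (x i)| <= c * `|x i| + e.
Proof.
move=> Ac c0 e0 Alow; apply: contrapT => nA.
pose w i := c * `|x i| + e.
have w0 i : 0 < w i by rewrite ltr_wpDl// mulr_ge0.
(* The gauge of the box; it is at least 1 on the image of any [l] that misses the conclusion. *)
pose q (z : 'rV[R]_n) := \big[Num.max/0]_i (`|z 0 i| / w i).
have qP (z : 'rV[R]_n) (M : R) : 0 <= M -> (forall i, `|z 0 i| <= M * w i) -> q z <= M.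
  by move=> M0 zM; apply: bigmax_le => // i _; rewrite ler_pdivrMr.
have zq (z : 'rV[R]_n) i : `|z 0 i| <= q z * w i.
  rewrite -ler_pdivrMr//.
  exact: (le_bigmax _ (fun i => `|z 0 i| / w i) i).
have q0 (z : 'rV[R]_n) : 0 <= q z by exact: bigmax_ge_id.
have sq : sublinear q.
  split=> [y z|t z t0].
    apply: qP => [|i]; first exact: addr_ge0.
    by rewrite mxE mulrDl (le_trans (ler_normD _ _))// lerD.
  apply: qP => [|i]; first exact: mulr_ge0.
  by rewrite mxE normrM ger0_norm// -mulrA ler_wpM2l.
pose ev (l : dual R X) : 'rV[R]_n := \row_i l (x i).
have [||| f [linf fq fA]] := @mazur_orlicz R _ q [set ev l | l in A] 1 sq.
- by have [l Al _] := Alow 0 1 ltr01; exists (ev l), l.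
- move=> _ _ t s [l Al <-] [l' Al' <-] t0 s0 ts.
  exists (t *: l + s *: l'); first exact: convex_setP.
  by apply/rowP => i; rewrite !mxE.
- move=> _ [l Al <-]; rewrite leNgt; apply/negP => q1.
  apply: nA; exists l => // i.
  have := zq (ev l) i; rewrite mxE => /le_trans -> //.
  by rewrite -[leRHS]mul1r ler_wpM2r// ltW.
pose flin : {linear 'rV[R]_n -> R^o} := HB.pack f (GRing.isLinear.Build _ _ _ _ f linf).
pose a i : R := f 'e_i.
have fE z : f z = \sum_i z 0 i * a i.
  rewrite {1}(row_sum_delta z) -[f]/(flin : _ -> _) linear_sum.
  by apply: eq_bigr => i _; rewrite linearZ.
have aw1 : \sum_i `|a i| * w i <= 1.
  (* A point of the box where [f] is largest. *)
  pose z : 'rV[R]_n := \row_i (Num.sg (a i) * w i).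
  have <- : f z = \sum_i `|a i| * w i.
    rewrite fE; apply: eq_bigr => i _.
    by rewrite mxE mulrAC -normrEsg.
  apply: le_trans (fq z) _; apply: qP => // i.
  rewrite mxE normrM mul1r (gtr0_norm (w0 i)) ler_piMl ?(ltW (w0 i))//.
  by rewrite normr_sg; case: (a i != 0); rewrite ?ler01 ?lexx.
(* In this direction every [l] of [A] satisfies [l v = - f (ev l) <= -1], while [c * |v| < 1] lets
   the hypothesis produce an [l] with [l v > -1]. *)
pose v := - \sum_i a i *: x i.
have vle : c * `|v| <= \sum_i `|a i| * (c * `|x i|).
  rewrite normrN (le_trans (ler_wpM2l c0 (ler_norm_sum _ _ _)))// mulr_sumr.
  by apply: ler_sum => i _; rewrite normrZ mulrCA.
have lv (l : dual R X) : l v = - f (ev l).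
  rewrite linearN linear_sum fE; congr (- _); apply: eq_bigr => i _.
  by rewrite linearZ mxE mulrC.
have vlt1 : c * `|v| < 1.
  have [a0|] := pselect (forall i, a i = 0).
    apply: le_lt_trans ltr01; apply: le_trans vle _.
    by rewrite big1// => i _; rewrite a0 normr0 mul0r.
  move=> /existsNP[i /eqP ai0].
  (* The margin [e] in [w i] makes the inequality strict, as [a i] is nonzero. *)
  apply: le_lt_trans vle (lt_le_trans _ aw1).
  under [ltRHS]eq_bigr do rewrite mulrDr.
  rewrite big_split/= ltrDl (bigD1 i)//= ltr_pwDl//.
    by rewrite mulr_gt0// normr_gt0.
  by apply: sumr_ge0 => j _; rewrite mulr_ge0// ltW.
have [|l Al] := Alow v ((1 - c * `|v|) / 2).
  by rewrite divr_gt0// subr_gt0.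
rewrite lv; have /fA : [set ev l | l in A] (ev l) by exists l.
by move: (f _) => y; lra.
Qed.

Lemma ultra_cvg_itv (T : Type) (F : set_system T) (h : T -> R) (M : R) :
  UltraFilter F -> F [set t | `|h t| <= M] -> exists r : R, h @ F --> r.
Proof.
move=> FU FM; have FF : ProperFilter F by case: (FU).
have cK : compact `[-M, M]%classic by exact: segment_compact.
have [|r [_ rcl]] := cK (h @ F) _.
  suff: F (h @^-1` `[- M, M]) by [].
  by apply: filterS FM => t; rewrite /= in_itv/= ler_norml.
exists r => U Ur /=.
have [//|FnU] := in_ultra_setVsetC (h @^-1` U) FU.
by have [y [yU yN]] := rcl (~` U) U FnU Ur.
Qed.

(** The minimax step: from one element of [A] per direction to one for all directions. Finite sets
    of directions are handled by separation in R^n; an ultrafilter refining the resulting sets [S p]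
    then converges pointwise, and the limit stays in [A] by w*-closedness. *)
Lemma weak_star_closed_small A (c : R) : 0 <= c ->
  weak_star_closed A -> convex_set A ->
  (forall v e, 0 < e -> exists2 l, A l & - (c * `|v|) - e <= l v) ->
  exists2 l, A l & `|l| <= c.
Proof.
move=> c0 Acl Ac Alow.
pose S (p : seq X * R) :=
  [set l | A l /\ forall x, x \in p.1 -> `|l x| <= c * `|x| + p.2].
pose D := [set p : seq X * R | 0 < p.2].
have S0 p : D p -> S p !=set0.
  case: p => s e /= e0.
  have [l Al lP] := @convex_dual_finite_approx A c e _ (tnth (in_tuple s)) Ac c0 e0 Alow.
  by exists l; split=> // x /= /(tnthP (in_tuple s))[i ->].
have FF : Filter (filter_from D S).
  apply: filter_from_filter; first by exists ([::], 1) => /=; exact: ltr01.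
  move=> [s e] [s' e'] /= e0 e0'.
  exists (s ++ s', Num.min e e'); first by rewrite /D/= lt_min e0.
  move=> l [Al lP]; split; split=> // x xs /=.
    by rewrite (le_trans (lP x _))/= ?mem_cat ?xs// lerD2l ge_min lexx.
  by rewrite (le_trans (lP x _))/= ?mem_cat ?xs ?orbT// lerD2l ge_min lexx orbT.
have [F [FU SF]] := ultraFilterLemma (filter_from_proper FF S0).
have FP : ProperFilter F by case: (FU).
have FS x e : 0 < e -> F [set l : dual R X | A l /\ `|l x| <= c * `|x| + e].
  move=> e0; apply: SF; exists ([:: x], e) => // l [Al lP]; split=> //.
  by apply: lP; rewrite inE.
have FA : F A by apply: filterS (FS 0 1 ltr01) => l [].
(* The Banach-Alaoglu argument: along [F] the values at [x] are bounded by [c * |x| + 1], so they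
   converge. *)
have /choice[h hP] x : exists r : R, (fun l : dual R X => l x) @ F --> r.
  by apply: (@ultra_cvg_itv _ _ _ (c * `|x| + 1)) => //; apply: filterS (FS x 1 ltr01) => l [].
have linh : linear (h : X -> R^o).
  move=> a x y; apply: (cvg_unique _ (hP _)); first exact: norm_hausdorff.
  rewrite (_ : (fun l : dual R X => _) =
      (fun l : dual R X => a * l x + l y)); last first.
    by apply/funext => l; rewrite linearP.
  by apply: cvgD; [apply: cvgM; [exact: cvg_cst | exact: hP] | exact: hP].
have hle x : h x <= c * `|x|.
  apply/ler_addgt0Pr => e e0.
  apply: (closed_cvg (fun r : R => r <= c * `|x| + e)) (hP x).
    exact: closed_le.
  apply: filterS (FS x e e0) => l [_]; apply: le_trans; exact: ler_norm.
have [l lE lc] := dual_of_linear linh c0 hle.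
exists l => //; apply: Acl => U Ul.
apply: (@filter_ex _ F); apply: filterI => //.
have := Ul; rewrite nbhsE => -[B [[W oW <-] Wl] WU]; apply: (filterS WU).
have cvgl : (fun l' : dual R X => (l' : {ptws X -> R^o})) @ F -->
    (l : {ptws X -> R^o}).
  apply/pointwise_cvgP => x; rewrite -[(l : X -> R) x]/(l x) lE; exact: hP.
by apply: cvgl; exact: open_nbhs_nbhs.
Qed.

End weak_star.

(** * Real induction and Ekeland's principle *)

Section real_induction.
Context (R : realType).

(** Connectedness of the unit interval: the supremum of the [s] such that [P] holds on [0, s] is
    attained by the limit step and would be exceeded by the progress step if it were below 1. *)
Lemma real_induction (P : R -> Prop) : P 0 ->
  (forall s, 0 <= s < 1 -> (forall t, 0 <= t <= s -> P t) ->
    exists2 d, 0 < d & forall t, s < t < s + d -> t <= 1 -> P t) ->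
  (forall s, 0 < s <= 1 -> (forall t, 0 <= t < s -> P t) -> P s) ->
  forall s, 0 <= s <= 1 -> P s.
Proof.
move=> P0 Pstep Plim.
pose S := [set s : R | 0 <= s <= 1 /\ forall t, 0 <= t <= s -> P t].
have S0 : S 0.
  split; first by rewrite lexx ler01.
  by move=> t /le_anti <-.
have supS : has_sup S by split; [exists 0 | exists 1 => s [/andP[]]].
set u := sup S.
have u0 : 0 <= u by exact: ub_le_sup supS.2 _ S0.
have u1 : u <= 1 by apply: ge_sup supS.1 _ => s [/andP[]].
have Plt t : 0 <= t < u -> P t.
  move=> /andP[t0 tu]; have [|s [_ sP]] := @sup_adherent _ S (u - t) _ supS.
    by rewrite subr_gt0.
  by rewrite subKr => ts; apply: sP; rewrite t0 ltW.
have Su : S u.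
  split; first by rewrite u0.
  move=> t /andP[t0]; rewrite le_eqVlt => /predU1P[->|tu]; last first.
    by apply: Plt; rewrite t0.
  move: u0; rewrite le_eqVlt => /predU1P[<-//|u0].
  by apply: Plim => //; rewrite u0.
move=> s /andP[s0 s1]; have [su|us] := leP s u; first by apply: Su.2; rewrite s0.
have [|d d0 dP] := Pstep u _ Su.2; first by rewrite u0 (lt_le_trans us).
pose v := Num.min s (u + d / 2).
have uv : u < v by rewrite lt_min us ltrDl divr_gt0.
have : S v.
  split; first by rewrite (le_trans u0 (ltW uv)) ge_min s1.
  move=> t /andP[t0 tv]; have [tu|ut] := leP t u; first by apply: Su.2; rewrite t0.
  apply: dP; move: tv; rewrite le_min => /andP[ts tud].
    by rewrite ut/=; lra.
  exact: le_trans s1.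
by move/(ub_le_sup supS.2); rewrite leNgt uv.
Qed.

Lemma continuous_le0_left (h : R -> R) (s : R) : {for s, continuous h} -> 0 < s ->
  (forall t, 0 <= t < s -> h t <= 0) -> h s <= 0.
Proof.
move=> hc s0 hle.
apply: (closed_cvg (fun r : R => r <= 0)) (cvg_at_left_filter hc); first exact: closed_le.
near=> t; apply: hle; apply/andP; split; near: t.
  exact: nbhs_left_ge.
exact: nbhs_left_lt.
Unshelve. all: end_near. Qed.

(** With only right difference quotients bounded above, the inequality is propagated by real
    induction with slope [a + e], and [e] then tends to 0. *)
Lemma dini_mean_value (h : R -> R) (a : R) : continuous h ->
  (forall t e, 0 <= t < 1 -> 0 < e ->
    exists2 d, 0 < d & forall s, 0 < s < d -> h (t + s) <= h t + (a + e) * s) ->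
  h 1 <= h 0 + a.
Proof.
move=> hc hD; apply/ler_addgt0Pr => e e0; rewrite -addrA -[a + e]mulr1.
suff H t : 0 <= t <= 1 -> h t - (h 0 + (a + e) * t) <= 0.
  by rewrite -subr_le0 H// lexx ler01.
apply: (real_induction (P := fun t => h t - (h 0 + (a + e) * t) <= 0)) => {t}.
- by lra.
- move=> s s01 /(_ s); rewrite lexx (andP s01).1 => /(_ isT) hs.
  have [d d0 dP] := hD s e s01 e0; exists d => // t /andP[st td] _.
  have := dP (t - s); rewrite (addrC s) subrK subr_gt0 st ltrBlDl td => /(_ isT).
  by lra.
- move=> s /andP[s0 s1] hs.
  apply: (continuous_le0_left (h := fun t => h t - (h 0 + (a + e) * t))) => //.
  apply: cvgB; first exact: hc.
  by apply: cvgD; [exact: cvg_cst | apply: cvgM; [exact: cvg_cst|exact: cvg_id]].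
Qed.

End real_induction.

Section ekeland.
Context (R : realType) (X : completeNormedModType R).

(** The relation [S] is transitive, and taking [u n.+1] almost minimal for [phi] on [S (u n)]
    shrinks the sets [S (u n)] to a point [z]. A [w] violating the second claim would lie in [S z],
    hence in all these sets, and so coincide with [z]. *)
Lemma ekeland (phi : X -> R) (c : R) (x0 : X) : continuous phi ->
  (forall x, 0 <= phi x) -> 0 < c ->
  exists2 z, c * `|z - x0| <= phi x0 - phi z &
    forall w, w != z -> phi z - c * `|w - z| < phi w.
Proof.
move=> phic phi0 c0.
pose S x := [set w | c * `|w - x| <= phi x - phi w].
have Sxx x : S x x by rewrite /S/= !subrr normr0 mulr0.
have Strans x y z : S x y -> S y z -> S x z.
  rewrite /S/= => xy yz; have : `|z - x| <= `|z - y| + `|y - x| by exact: ler_distD.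
  by move/(ler_wpM2l (ltW c0)); lra.
have lb x : has_lbound (phi @` S x) by exists 0 => _ [w _ <-].
have /choice[nxt nxtP] (p : nat * X) : exists y, S p.2 y /\
    forall w, S p.2 w -> phi y <= phi w + harmonic p.1.
  case: p => n x /=.
  have [|_ [y Sy <-] yP] := @inf_adherent _ (phi @` S x) _ (harmonic_gt0 n).
    by split; [exists (phi x), x | exact: lb].
  exists y; split=> // w Sw; apply: ltW; apply: lt_le_trans yP _.
  by rewrite lerD2r; apply: ge_inf => //; exists w.
pose u := fix u n := if n is n'.+1 then nxt (n', u n') else x0.
have uS n k : (n <= k)%N -> S (u n) (u k).
  elim: k => [|k IH]; first by rewrite leqn0 => /eqP ->.
  rewrite leq_eqVlt => /predU1P[->//|/IH Snk].
  by apply: Strans Snk _; have [] := nxtP (k, u k).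
have uh n w : S (u n.+1) w -> c * `|w - u n.+1| <= harmonic n.
  move=> Sw; have [Sn /(_ w)] := nxtP (n, u n); rewrite -/(u n.+1) => h.
  have : phi (u n.+1) <= phi w + harmonic n by exact: h (Strans _ _ _ Sn Sw).
  have : c * `|w - u n.+1| <= phi (u n.+1) - phi w := Sw.
  by lra.
have small e : 0 < e -> \forall n \near \oo, harmonic n < c * e.
  move=> e0; have ce : 0 < c * e by rewrite mulr_gt0.
  exact: (near_infty_natSinv_lt (PosNum ce)).
have /cvg_ex[z uz] : cvg (u @ \oo).
  apply: cauchy_cvg; apply: cauchy_exP => e e0.
  have [N _ /(_ N (leqnn N)) Ne] := small e e0.
  exists (u N.+1); exists N.+1 => // k /= /uS /uh Nk.
  by rewrite -ball_normE /ball_/= distrC -(ltr_pM2l c0) (le_lt_trans Nk).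
have Suz n : S (u n) z.
  rewrite /S/= -subr_le0.
  apply: (@closed_cvg _ _ \oo _ (fun k => c * `|u k - u n| - (phi (u n) - phi (u k)))
    (fun r : R => r <= 0)); first exact: closed_le.
    exists n => // k /= /uS; rewrite /S/= -subr_le0; exact.
  apply: cvgB; last by apply: cvgB; [exact: cvg_cst | exact: (cvg_comp _ _ uz (phic z))].
  apply: cvgM; first exact: cvg_cst.
  by apply: cvg_norm; apply: cvgB => //; exact: cvg_cst.
exists z; first exact: Suz 0.
move=> w wz; rewrite ltNge; apply/negP => wle.
have Sw : S z w by rewrite /S/=; lra.
have : 0 < `|w - z| / 2 by rewrite divr_gt0// normr_gt0 subr_eq0.
move=> /small[N _ /(_ N (leqnn N)) Ne].
have h1 := uh N z (Suz _); have h2 := uh N w (Strans _ _ _ (Suz _) Sw).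
have : `|w - z| <= `|w - u N.+1| + `|z - u N.+1|.
  by rewrite (distrC z); exact: ler_distD.
by move/(ler_wpM2l (ltW c0)); lra.
Qed.

End ekeland.

(** * Local inversion of regular maps *)

Lemma convex_hull_convex (R : realType) (V : normedModType R) (A : set V) :
  convex_set (convex_hull A).
Proof.
move=> x y t; rewrite !inE => xA yA B [Bc AB].
by have := Bc x y t; rewrite !inE; apply; [exact: xA | exact: yA].
Qed.

Lemma co_image_le (R : realType) (X Y : normedModType R)
  (Jf : X -> set (blin X Y)) x r r' : r <= r' ->
  co_image Jf x r `<=` co_image Jf x r'.
Proof.
move=> rr'; apply: sub_smallest2r; first exact: convex_hull_convex.
by move=> T [z xz JT]; exists z => //; exact: le_ball xz.
Qed.

Section moduli.
Context (R : realType) (X Y : normedModType R).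
Implicit Types T : blin X Y.

Lemma surjectivity_modulus_le T (c : R) (l : dual R Y) :
  (c%:E <= surjectivity_modulus T)%E -> c * `|l| <= `|blin_comp l T|.
Proof.
move=> cT; have [->|l0] := eqVneq l 0; first by rewrite normr0 mulr0.
have nl0 : 0 < `|l| by rewrite normr_gt0.
rewrite -ler_pdivlMr//.
have -> : `|blin_comp l T| / `|l| = `|blin_comp (`|l|^-1 *: l) T|.
  have -> : blin_comp (`|l|^-1 *: l) T = `|l|^-1 *: blin_comp l T by exact/val_inj.
  by rewrite normrZ gtr0_norm ?invr_gt0// mulrC.
rewrite -lee_fin; apply: le_trans cT _; apply: ereal_inf_lbound.
by exists (`|l|^-1 *: l) => //=; rewrite normrZ gtr0_norm ?invr_gt0// mulVf ?gt_eqF.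
Qed.

(** This is how a bound on the surjectivity index controls injectivity. For [xi] norming [u], the
    functional [l] obtained by composing [xi] with the inverse of [T] satisfies
    [c * |l| <= |xi| <= 1] and [l (T u) = |u|]. *)
Lemma isomorphism_bounded_below T (c : R) (u : X) : isomorphism T ->
  (c%:E <= surjectivity_modulus T)%E -> c * `|u| <= `|T u|.
Proof.
move=> [S [TS ST]] cT; have [c0|c0] := leP c 0.
  by apply: le_trans (normr_ge0 _); rewrite mulr_le0_ge0.
have [xi xi1 xiu] := norming_functional u.
pose l : dual R Y := blin_comp xi S.
have lT : blin_comp l T = xi by apply/val_inj/funext => x /=; rewrite TS.
have cl : c * `|l| <= 1.
  by apply: le_trans (surjectivity_modulus_le l cT) _; rewrite lT.
rewrite -xiu -[u in xi u]TS -[xi _]/(l (T u)).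
apply: (@le_trans _ _ (c * (`|l| * `|T u|))).
  by rewrite ler_pM2l// (le_trans (ler_norm _))// le_opnorm.
by rewrite mulrA -[leRHS]mul1r ler_wpM2r.
Qed.

Lemma sur_index_gt (Jf : X -> set (blin X Y)) (x : X) (c : R) :
  (c%:E < sur_index Jf x)%E -> exists2 r, 0 < r &
    forall T, co_image Jf x r T -> (c%:E <= surjectivity_modulus T)%E.
Proof.
move=> /ereal_sup_gt[_ [r /= r0 <-] cr]; exists r => // T JT.
by apply: le_trans (ltW cr) _; apply: ereal_inf_lbound; exists T.
Qed.

(** The subgradient inequality at [z + v] gives norm at most 1; at 0 it gives [l z >= |z|]. *)
Lemma norm_subdifferential_norm (z : Y) (l : dual R Y) : z != 0 ->
  norm_subdifferential z l -> `|l| = 1.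
Proof.
move=> z0 zl; apply/le_anti/andP; split.
  have lle v : l v <= `|v|.
    by have := zl (z + v); rewrite addrAC subrr add0r; have := ler_normD z v; lra.
  apply: opnorm_le => // v; rewrite mul1r ler_norml lle andbT lerNl.
  by rewrite -linearN (le_trans (lle _))// normrN.
have nz : 0 < `|z| by rewrite normr_gt0.
have := zl 0; rewrite normr0 !sub0r linearN lerN2 => lz.
rewrite -(ler_pM2r nz) mul1r (le_trans lz)// (le_trans (ler_norm _))//.
exact: le_opnorm.
Qed.

Lemma closed_convex_hull_approx (A : set (blin X Y)) T (e : R) : 0 < e ->
  closed_convex_hull A T -> exists2 T', convex_hull A T' & `|T' - T| < e.
Proof.
move=> e0 /(_ (ball T e) (nbhsx_ballx _ _ e0))[T' [AT' TT']]; exists T' => //.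
by move: TT'; rewrite -ball_normE /ball_/= distrC.
Qed.

Lemma dini_upper_lt (phi : X -> R) (x v : X) (a : R) :
  (dini_upper phi x v < a%:E)%E ->
  exists2 d, 0 < d & forall s, 0 < s < d -> phi (x + s *: v) <= phi x + a * s.
Proof.
move=> /ereal_inf_lt[_ [U [d /= d0 dU] <-] Ua]; exists d => // s /andP[s0 sd].
rewrite -lerBlDl -ler_pdivrMr// -lee_fin; apply: le_trans (ltW Ua).
apply: ereal_sup_ubound; exists s => //; apply: dU => //=.
by rewrite sub0r normrN gtr0_norm.
Qed.

End moduli.

Section local_inversion.
Context (R : realType) (X Y : completeNormedModType R).
Context (f : X -> Y) (Jf : X -> set (blin X Y)).
Hypothesis fc : continuous f.

Lemma segment_in_ball (x u w : X) (r t : R) : ball x r u -> ball x r w ->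
  0 <= t <= 1 -> ball x r (w + t *: (u - w)).
Proof.
rewrite -!ball_normE /ball_/= => xu xw /andP[t0 t1].
have -> : x - (w + t *: (u - w)) = (1 - t) *: (x - w) + t *: (x - u).
  rewrite opprD addrA scalerBl scale1r -[RHS]addrA; congr (_ + _).
  by rewrite -!scalerN -scalerDr !opprB addrA subrK.
apply: (le_lt_trans (ler_normD _ _)); rewrite !normrZ !ger0_norm ?subr_ge0//.
have [->|t0'] := eqVneq t 0; first by rewrite subr0 mul1r mul0r addr0.
have tp : 0 < t by rewrite lt_neqAle eq_sym t0'.
have : (1 - t) * `|x - w| <= (1 - t) * r by rewrite ler_wpM2l ?subr_ge0// ltW.
have : t * `|x - u| < t * r by rewrite ltr_pM2l.
by lra.
Qed.

(** The vectors [T h], for [T] in the hull, form a convex set outside the open ball of radius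
    [c * |h|], so a single [l] of norm at most 1 is at least [c * |h|] on all of them; the mean
    value inequality integrates this along the segment. *)
Lemma pseudo_jacobian_expanding (x : X) (r c : R) : pseudo_jacobian f Jf ->
  (forall T, co_image Jf x r T -> forall v, c * `|v| <= `|T v|) ->
  forall u w, ball x r u -> ball x r w -> c * `|u - w| <= `|f u - f w|.
Proof.
move=> pJ cT u w xu xw; set h := u - w.
have segb t : 0 <= t <= 1 -> ball x r (w + t *: h) by exact: segment_in_ball.
have JT z T : ball x r z -> Jf z T -> co_image Jf x r T.
  by move=> xz JT; apply: sub_gen_smallest; exists z.
have [||_ [T TJ <-]|l l1 lA] :=
    @convex_norm_separation _ Y [set T h | T in co_image Jf x r] (c * `|h|).
- have [[T JwT] _] := pJ w; exists (T h), T => //; exact: JT JwT.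
- move=> _ _ t s [T TJ <-] [T' TJ' <-] t0 s0 ts; exists (t *: T + s *: T') => //.
  exact: convex_setP (@convex_hull_convex _ _ _) _ _ _ _ TJ TJ' t0 s0 ts.
- exact: cT.
(* Pseudo-Jacobians bound upper derivatives from above, hence the sign. *)
pose phi t := - l (f (w + t *: h)).
have linec : continuous (fun t : R => w + t *: h).
  by move=> t; apply: cvgD; [exact: cvg_cst | apply: cvgZl; exact: cvg_id].
have phic : continuous phi.
  move=> t; apply: cvgN; apply: (cvg_comp (fun t => w + t *: h) (l \o f) (linec t)).
  by apply: cvg_comp; [exact: fc | exact: blin_continuous].
have : phi 1 <= phi 0 + - (c * `|h|).
  apply: dini_mean_value => // t e t01 e0.
  set z := w + t *: h.
  have xz : ball x r z by apply: segb; rewrite (andP t01).1 (ltW (andP t01).2).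
  have [_ /(_ (- l) h) dz] := pJ z.
  have [|d d0 dP] := @dini_upper_lt _ _ (- l \o f) z h (- (c * `|h|) + e).
    apply: (@le_lt_trans _ _ (- (c * `|h|))%:E); last by rewrite lte_fin ltrDl.
    apply: le_trans dz _; apply: ge_ereal_sup => _ [T JzT <-].
    rewrite lee_fin -[(- l) _]/(- l _) lerN2; apply: lA; exists T => //.
    exact: JT JzT.
  by exists d => // s /dP; rewrite /phi scalerDl addrA.
rewrite /phi scale1r scale0r addr0 /h addrC subrK => H.
have : c * `|u - w| <= l (f u - f w) by rewrite linearB/= /h; lra.
move=> /le_trans; apply; apply: le_trans (ler_norm _) _.
by rewrite (le_trans (le_opnorm _ _))// -[leRHS]mul1r ler_wpM2r.
Qed.

(** At an Ekeland point [z] of [|f - y|] with [f z] different from [y], no direction has slope below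
    [- c * |v|], so [chain_rule_set] contains some [l \o T] of norm at most [c]; but [l] has norm 1
    and the modulus of operators near [T] is at least [c1 > c]. *)
Lemma chain_rule_open (x : X) (r c c1 : R) : chain_rule_condition f Jf ->
  0 < c < c1 ->
  (forall T, co_image Jf x r T -> (c1%:E <= surjectivity_modulus T)%E) ->
  forall y, `|f x - y| < c * r -> exists2 z, ball x r z & f z = y.
Proof.
move=> crc /andP[c0 cc1] cT y yr.
pose phi (z : X) := `|f z - y|.
have phic : continuous phi.
  by move=> z; apply: cvg_norm; apply: cvgB; [exact: fc | exact: cvg_cst].
have [z zx zmin] := ekeland x phic (fun _ => normr_ge0 _) c0.
have xz : ball x r z.
  rewrite -ball_normE /ball_/= distrC -(ltr_pM2l c0); apply: le_lt_trans zx _.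
  by apply: le_lt_trans yr; rewrite gerBl normr_ge0.
exists z => //; apply: contrapT => fzy.
have [Acl Ac [_ pA]] := crc z y (fun e => fzy (esym e)).
(* The identity of the reals, the functional with which the real-valued [phi] is tested. *)
have [||l1 l1E _] := @dual_of_linear R R^o (id : R^o -> R^o) 1 _ ler01 _.
- by [].
- by move=> t; rewrite mul1r ler_norm.
have [|_ [l lz [T TJ <-]] lTc] := weak_star_closed_small (ltW c0) Acl Ac.
  move=> v e e0; apply: contrapT => nA.
  (* Otherwise all functionals of the set are below [- c * |v| - e] at [v], and [phi] decreases
     along [v] faster than the Ekeland point allows. *)
  have [|d d0 dP] := @dini_upper_lt _ _ phi z v (- (c * `|v|) - e / 2).
    have -> : phi = l1 \o phi by apply/funext => t; rewrite /= l1E.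
    apply: (@le_lt_trans _ _ (- (c * `|v|) - e)%:E); last by rewrite lte_fin; lra.
    apply: le_trans (pA l1 v) _; apply: ge_ereal_sup => _ [xi Axi <-].
    rewrite l1E lee_fin leNgt; apply/negP => h; apply: nA; exists xi => //.
    exact: ltW.
  have d20 : 0 < d / 2 by lra.
  have /dP : 0 < d / 2 < d by lra.
  have vd : 0 <= c * `|v| * (d / 2) by rewrite !mulr_ge0// ltW.
  have ed : 0 < e / 2 * (d / 2) by rewrite !mulr_gt0//; lra.
  have [->|/zmin] := eqVneq (z + (d / 2) *: v) z; first by lra.
  by rewrite addrAC subrr add0r normrZ gtr0_norm//; lra.
have ln1 : `|l| = 1.
  by apply: norm_subdifferential_norm lz; rewrite subr_eq0; apply/eqP.
(* The modulus is bounded below on the hull only, not on its closure; the gap [c1 - c] absorbs the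
   replacement of [T] by [T']. *)
have [|T' T'J T'T] := @closed_convex_hull_approx _ _ _ _ T (c1 - c) _ TJ.
  by rewrite subr_gt0.
have /cT c1T' : co_image Jf x r T'.
  apply: (sub_smallest2r (@convex_hull_convex _ _ _)) T'J.
  by move=> S JS; exists z.
have := surjectivity_modulus_le l c1T'; rewrite ln1 mulr1 leNgt => /negP; apply.
apply: (@le_lt_trans _ _ (`|blin_comp l T| + `|T' - T|)); last by lra.
apply: opnorm_le => [|v]; first by rewrite addr_ge0.
rewrite -[blin_comp l T' v]/(l (T' v)) -(subrK (T v) (T' v)) linearD.
rewrite (le_trans (ler_normD _ _))// mulrDl addrC lerD//.
  exact: (le_opnorm (blin_comp l T)).
apply: (le_trans (le_opnorm l _)); rewrite -[opnorm l]/`|l| ln1 mul1r.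
exact: (le_opnorm (T' - T)).
Qed.

(** Expansion and openness share one ball and one constant, so preimages found in the ball are
    unique there and depend on their values in a Lipschitz way. *)
Lemma regular_local_inversion (x : X) (c : R) : pseudo_jacobian f Jf ->
  chain_rule_condition f Jf -> regular_at Jf x -> 0 < c ->
  (c%:E < reg_index Jf x)%E ->
  exists r, [/\ 0 < r,
    forall u w, ball x r u -> ball x r w -> c * `|u - w| <= `|f u - f w| &
    forall y, `|f x - y| < c * r -> exists2 z, ball x r z & f z = y].
Proof.
move=> pJ crc [[r1 r10 iso] _] c0 cx.
have [c1 cc1 c1x] : exists2 c1 : R, c < c1 & (c1%:E < reg_index Jf x)%E.
  move: cx; case: (reg_index Jf x) => [s|_|//].
    by rewrite lte_fin => cs; exists ((c + s) / 2); rewrite ?lte_fin; lra.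
  (* The index can be infinite, for instance when [Y] is zero. *)
  by exists (c + 1); rewrite ?ltry; lra.
have [r2 r20 sur] := sur_index_gt c1x.
pose r := Num.min r1 r2.
have r0 : 0 < r by rewrite lt_min r10.
have surr T : co_image Jf x r T -> (c1%:E <= surjectivity_modulus T)%E.
  by move=> JT; apply: sur; apply: co_image_le JT; rewrite ge_min lexx orbT.
exists r; split=> //.
  apply: pseudo_jacobian_expanding => // T JT v.
  apply: isomorphism_bounded_below.
    by apply: iso; apply: co_image_le JT; rewrite ge_min lexx.
  by apply: le_trans (surr _ JT); rewrite lee_fin ltW.
by apply: (chain_rule_open (c1 := c1)) => //; rewrite c0.
Qed.

End local_inversion.

(** * Minorants of a lower semicontinuous function *)

(* Stands for the integral of [m], which need not be locally finite. *)
Definition subpotential (R : realType) (m Phi : R -> R) (K : R) :=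
  [/\ Phi 0 = 0,
    forall t s, 0 <= t <= s -> 0 <= Phi s - Phi t <= K * (s - t) &
    forall t, 0 <= t -> exists c d, [/\ 0 < c < m t, 0 < d &
      forall s, t <= s < t + d -> Phi s - Phi t <= c * (s - t)]].

Section lipschitz_minorant.
Context (R : realType).
Variable n : R -> R.
Hypothesis n0 : forall t, 0 < n t.
Hypothesis n_lsc : forall t a, a < n t ->
  exists2 d, 0 < d & forall s, `|s - t| < d -> a < n s.

(* Pasch-Hausdorff envelope of the truncation of [n] at height [k]. *)
Definition lipschitz_minorant (k t : R) : R :=
  inf (range (fun s => Num.min (n s) k + k * `|s - t|)).

Let lb (k t : R) : 0 <= k ->
  has_lbound (range (fun s => Num.min (n s) k + k * `|s - t|)).
Proof.
move=> k0; exists 0 => _ [s _ <-].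
by rewrite addr_ge0 ?mulr_ge0// le_min k0 andbT ltW.
Qed.

Lemma lipschitz_minorant_le k t s : 0 <= k ->
  lipschitz_minorant k t <= Num.min (n s) k + k * `|s - t|.
Proof. by move=> k0; apply: ge_inf; [exact: lb | exists s]. Qed.

Lemma lipschitz_minorant_ge k t M :
  (forall s, M <= Num.min (n s) k + k * `|s - t|) -> M <= lipschitz_minorant k t.
Proof.
move=> H; apply: lb_le_inf => [|_ [s _ <-]]; last exact: H.
by exists (Num.min (n 0) k + k * `|0 - t|), 0.
Qed.

Lemma lipschitz_minorant_ge0 k t : 0 <= k -> 0 <= lipschitz_minorant k t.
Proof.
move=> k0; apply: lipschitz_minorant_ge => s.
by rewrite addr_ge0 ?mulr_ge0// le_min k0 andbT ltW.
Qed.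

Lemma lipschitz_minorant_len k t : 0 <= k -> lipschitz_minorant k t <= n t.
Proof.
move=> k0; apply: le_trans (lipschitz_minorant_le t t k0) _.
by rewrite subrr normr0 mulr0 addr0 ge_min lexx.
Qed.

Lemma lipschitz_minorant_lek k t : 0 <= k -> lipschitz_minorant k t <= k.
Proof.
move=> k0; apply: le_trans (lipschitz_minorant_le t t k0) _.
by rewrite subrr normr0 mulr0 addr0 ge_min lexx orbT.
Qed.

Lemma lipschitz_minorant_lipschitz k t s : 0 <= k ->
  lipschitz_minorant k t <= lipschitz_minorant k s + k * `|t - s|.
Proof.
move=> k0; rewrite -lerBlDr; apply: lipschitz_minorant_ge => u.
have := lipschitz_minorant_le t u k0.
have := ler_wpM2l k0 (ler_distD s u t); rewrite (distrC s t); lra.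
Qed.

Lemma lipschitz_minorant_mono k k' t : 0 <= k -> k <= k' ->
  lipschitz_minorant k t <= lipschitz_minorant k' t.
Proof.
move=> k0 kk'; apply: lipschitz_minorant_ge => s.
apply: le_trans (lipschitz_minorant_le t s k0) _; apply: lerD.
  by rewrite le_min ge_min lexx/= ge_min kk' orbT.
by rewrite ler_wpM2r.
Qed.

Lemma lipschitz_minorant_continuous k : 0 <= k -> continuous (lipschitz_minorant k).
Proof.
move=> k0 t; apply/cvgrPdist_le => e e0.
have k1 : 0 < k + 1 by lra.
near=> s.
have : (k + 1) * `|t - s| <= e.
  rewrite mulrC -ler_pdivlMr//; near: s; apply: cvgr_dist_le => //.
  by rewrite divr_gt0.
have := lipschitz_minorant_lipschitz t s k0.
have := lipschitz_minorant_lipschitz s t k0; rewrite (distrC s t).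
have := normr_ge0 (t - s); rewrite ler_norml; lra.
Unshelve. all: end_near. Qed.

(** Within distance [d] of [t] the truncation at height [k >= a] stays above [a]; farther away the
    penalty is at least [k * d >= a]. Hence the minorants converge to [n]. *)
Lemma lipschitz_minorant_gt t a : a < n t ->
  exists K, forall k, K <= k -> a <= lipschitz_minorant k t.
Proof.
move=> /n_lsc[d d0 dP]; exists (Num.max 1 (Num.max a (a / d))) => k.
rewrite !ge_max => /and3P[k1 ak adk]; apply: lipschitz_minorant_ge => s.
have [sd|ds] := ltP `|s - t| d.
  have k0 : 0 <= k * `|s - t| by rewrite mulr_ge0//; lra.
  have : a <= Num.min (n s) k by rewrite le_min ak andbT ltW// dP.
  by lra.
have : a <= k * d by rewrite -ler_pdivrMr.
have : k * d <= k * `|s - t| by rewrite ler_wpM2l//; lra.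
have : 0 <= Num.min (n s) k by rewrite le_min ltW//=; lra.
by lra.
Qed.

Lemma lipschitz_minorant_gt0 k t : 0 < k -> 0 < lipschitz_minorant k t.
Proof.
move=> k0; have [|d d0 dP] := @n_lsc t (n t / 2); first by have := n0 t; lra.
apply: (@lt_le_trans _ _ (Num.min (Num.min (n t / 2) k) (k * d))).
  have kd0 : 0 < k * d by rewrite mulr_gt0.
  by rewrite !lt_min k0 kd0 !andbT; have := n0 t; lra.
apply: lipschitz_minorant_ge => s.
have ks0 : 0 <= k * `|s - t| by rewrite mulr_ge0// ltW.
have ns0 : 0 <= Num.min (n s) k by rewrite le_min !ltW.
have [/dP sd|ds] := ltP `|s - t| d.
  apply: (@le_trans _ _ (Num.min (n s) k)); last by lra.
  by rewrite ge_min; apply/orP; left; rewrite le_min !ge_min lexx (ltW sd) orbT.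
apply: (@le_trans _ _ (k * d)); first by rewrite ge_min lexx orbT.
have : k * d <= k * `|s - t| by rewrite ler_wpM2l// ltW.
by lra.
Qed.

(** The positive continuous minorant with [k = 1] attains its minimum on the segment. *)
Lemma lsc_segment_lower_bound (r : R) : 0 <= r ->
  exists2 c, 0 < c & forall t, 0 <= t <= r -> c <= n t.
Proof.
move=> r0.
have [|u _ uP] := @EVT_min _ (lipschitz_minorant 1) 0 r r0.
  by apply: continuous_subspaceT; exact: lipschitz_minorant_continuous.
exists (lipschitz_minorant 1 u); first exact: lipschitz_minorant_gt0.
move=> t t0r; apply: le_trans (lipschitz_minorant_len _ _) => //.
by apply: uP; rewrite in_itv.
Qed.

Local Notation mu := (@lebesgue_measure R).

Lemma lipschitz_minorant_integrable k a b : 0 <= k ->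
  mu.-integrable `[a, b] (EFin \o lipschitz_minorant k).
Proof.
move=> k0; apply: continuous_compact_integrable; first exact: segment_compact.
by apply: continuous_subspaceT; exact: lipschitz_minorant_continuous.
Qed.

Lemma lipschitz_minorant_integral_unbounded (L : R) :
  (\int[mu]_(t in `[0%R, +oo[) (n t)%:E = +oo)%E ->
  exists2 k : R, 0 < k & L < \int[mu]_(t in `[0, k]) lipschitz_minorant k t.
Proof.
move=> noo; apply: contrapT => nL.
(* The index is at once height, slope and right end, so [g] increases to [n] on the half-line and
   monotone convergence applies. *)
pose g (k : nat) : R -> \bar R :=
  (EFin \o lipschitz_minorant k%:R) \_ `[0%R, k%:R].
have mD : measurable (`[0%R, +oo[%classic : set R) by exact: measurable_itv.
have g_ge0 k t : (0 <= g k t)%E.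
  rewrite /g patchE; case: ifPn => // _.
  by rewrite lee_fin lipschitz_minorant_ge0.
have gE k : (\int[mu]_(t in `[0%R, +oo[) g k t =
    (\int[mu]_(t in `[0%R, k%:R]) lipschitz_minorant k%:R t)%:E)%E.
  rewrite -integral_mkcondr setIidr; last first.
    by move=> t /=; rewrite !in_itv/= andbT => /andP[].
  rewrite /Rintegral fineK//; apply: integrable_fin_num => //.
  exact: lipschitz_minorant_integrable.
have g_nd t : {homo g^~ t : k k' / (k <= k')%N >-> (k <= k')%E}.
  move=> k k' kk'; have kk'R : k%:R <= k'%:R :> R by rewrite ler_nat.
  rewrite /g !patchE; case: ifPn => [|_]; last exact: g_ge0.
  rewrite inE/= in_itv/= => /andP[t0 tk].
  rewrite mem_set/=; last by rewrite in_itv/= t0 (le_trans tk).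
  by rewrite lee_fin lipschitz_minorant_mono.
have g_meas k : measurable_fun (`[0%R, +oo[%classic : set R) (g k).
  apply: measurable_funTS; apply/(measurable_restrictT _ _).1 => //.
  apply/measurable_EFinP; apply: measurable_funTS.
  by apply: continuous_measurable_fun; exact: lipschitz_minorant_continuous.
have : (\int[mu]_(t in `[0%R, +oo[) limn (g^~ t) <= L%:E)%E.
  rewrite monotone_convergence//.
  apply: lime_le.
    apply: ereal_nondecreasing_is_cvgn => k k' kk'.
    apply: ge0_le_integral => //; [exact: g_meas|exact: g_meas|].
    by move=> t _; exact: g_nd.
  (* Index 0 is skipped because [k] has to be positive. *)
  exists 1%N => // k /= k1; rewrite gE lee_fin leNgt; apply/negP => Lk.
  by apply: nL; exists k%:R => //; rewrite ltr0n.
rewrite (_ : (\int[mu]_(t in _) _)%E = +oo%E)//.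
rewrite -noo; apply: eq_integral => t; rewrite inE/= in_itv/= andbT => t0.
apply/cvg_lim => //.
have lim_min : (fun k : nat => lipschitz_minorant k%:R t) @ \oo --> n t.
  apply/cvgrPdist_le => e e0.
  have [|K KP] := @lipschitz_minorant_gt t (n t - e); first by rewrite gtrBl.
  near=> k.
  have := KP k%:R; have -> : K <= k%:R by near: k; exact: nbhs_infty_ger.
  move=> /(_ isT); have := lipschitz_minorant_len t (ler0n R k).
  by rewrite ler_norml; lra.
have gt_near : \forall k \near \oo, g k t = (lipschitz_minorant k%:R t)%:E.
  near=> k; rewrite /g patchE mem_set//= in_itv/= t0/=.
  by near: k; exact: nbhs_infty_ger.
apply: cvg_EFin; first by apply: filterS gt_near => k ->.
apply: cvg_trans lim_min; apply: near_eq_cvg.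
by apply: filterS gt_near => k /= ->.
Unshelve. all: end_near. Qed.

(** [Phi] is half the primitive of a minorant: the factor leaves room for slopes strictly below [n],
    and is the reason for asking an integral above [2 * L]. *)
Lemma lsc_subpotential :
  (\int[mu]_(t in `[0%R, +oo[) (n t)%:E = +oo)%E ->
  forall L, exists Phi r K, [/\ 0 < r, subpotential n Phi K & L < Phi r].
Proof.
move=> noo L.
have [k k0 Lk] := lipschitz_minorant_integral_unbounded (2 * L) noo.
have k0' := ltW k0.
pose Phi s := 2^-1 * \int[mu]_(t in `[0, s]) lipschitz_minorant k t.
have PhiB t s M : 0 <= t <= s ->
    (forall x, t <= x <= s -> lipschitz_minorant k x <= M) ->
    0 <= Phi s - Phi t <= 2^-1 * M * (s - t).
  move=> /andP[t0 ts] mM; rewrite /Phi -mulrBr Rintegral_itvB ?bnd_simp//; last first.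
    exact: lipschitz_minorant_integrable.
  apply/andP; split.
    rewrite mulr_ge0// Rintegral_ge0// => x _; exact: lipschitz_minorant_ge0.
  rewrite -mulrA ler_wpM2l//.
  have <- : \int[mu]_(x in `]t, s]) cst M x = M * (s - t).
    rewrite Rintegral_cst//= lebesgue_measure_itv/= lte_fin.
    by move: ts; rewrite le_eqVlt => /predU1P[->|->]; rewrite ?ltxx ?subrr.
  apply: le_Rintegral => //.
  - apply: integrableS (lipschitz_minorant_integrable t s k0') => //.
    by apply: subset_itvr; rewrite bnd_simp.
  - have : mu.-integrable `[t, s] (EFin \o cst M).
      apply: continuous_compact_integrable; first exact: segment_compact.
      by apply: continuous_subspaceT => x; exact: cvg_cst.
    by apply: integrableS => //; apply: subset_itvr; rewrite bnd_simp.
  - by move=> x /=; rewrite in_itv/= => /andP[tx xs]; apply: mM; rewrite xs ltW.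
exists Phi, k, (2^-1 * k); split=> //; last by rewrite /Phi; lra.
split.
- by rewrite /Phi set_itv1 Rintegral_set1 mulr0.
- by move=> t s ts; apply: PhiB => // x _; exact: lipschitz_minorant_lek.
- move=> t t0; have mt0 := lipschitz_minorant_gt0 t k0.
  have mtn := lipschitz_minorant_len t k0'.
  (* For this [d] the minorant stays below 3/2 of its value at [t], and half of 3/2 is 3/4. *)
  exists (3/4 * lipschitz_minorant k t), (lipschitz_minorant k t / 2 / k); split.
  + by apply/andP; split; lra.
  + by rewrite !divr_gt0.
  + move=> s /andP[ts std].
    have kst : k * (s - t) <= lipschitz_minorant k t / 2.
      by rewrite mulrC -ler_pdivlMr//; lra.
    have /andP[_] : 0 <= Phi s - Phi t <=
        2^-1 * (3 / 2 * lipschitz_minorant k t) * (s - t).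
      apply: PhiB => [|x /andP[tx xs]]; first by rewrite t0.
      have := lipschitz_minorant_lipschitz x t k0'; rewrite ger0_norm ?subr_ge0//.
      have : k * (x - t) <= k * (s - t) by rewrite ler_wpM2l// lerD2r.
      by lra.
    by rewrite mulrA (_ : 2^-1 * (3 / 2) = 3 / 4)//; lra.
Qed.

End lipschitz_minorant.

(** * Lifting of segments and global inversion *)

Section global_inversion.
Context (R : realType) (X Y : completeNormedModType R) (f : X -> Y) (m : R -> R).
Hypothesis fc : continuous f.

Definition expanding_on_ball (c : R) (x : X) (r : R) :=
  forall u w, ball x r u -> ball x r w -> c * `|u - w| <= `|f u - f w|.

Hypothesis f_inv : forall x c, 0 < c < m `|x| -> exists r, [/\ 0 < r,
  expanding_on_ball c x r &
  forall y, `|f x - y| < c * r -> exists2 z, ball x r z & f z = y].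
Hypothesis m_low : forall r, 0 <= r ->
  exists2 c, 0 < c & forall t, 0 <= t <= r -> c <= m t.
Hypothesis m_subpotential : forall L,
  exists Phi r K, [/\ 0 < r, subpotential m Phi K & L < Phi r].

Let seg (y : Y) (t : R) : Y := f 0 + t *: (y - f 0).

Let segB y s t : seg y s - seg y t = (s - t) *: (y - f 0).
Proof. by rewrite /seg opprD addrACA subrr add0r scalerBl. Qed.

(** The constant [K] is recorded because a uniform Lipschitz bound makes lifts converge at the end
    of a half-open interval. *)
Definition is_lift (y : Y) (s K : R) (u : R -> X) :=
  [/\ 0 <= K, u 0 = 0, forall t, 0 <= t <= s -> f (u t) = seg y t &
    forall t t', 0 <= t <= t' -> t' <= s -> `|u t' - u t| <= K * (t' - t)].

Lemma is_lift_norm y s K u t : is_lift y s K u -> 0 <= t <= s -> `|u t| <= K * t.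
Proof.
move=> [_ u0 _ uK] /andP[t0 ts].
by have := uK 0 t; rewrite u0 !subr0 lexx t0; apply.
Qed.

Lemma expanding_shrink c x r z r' : expanding_on_ball c x r ->
  `|z - x| + r' <= r -> expanding_on_ball c z r'.
Proof.
move=> xr zr u w zu zw.
suff sub v : ball z r' v -> ball x r v by apply: xr; exact: sub.
rewrite -!ball_normE /ball_/= => zv.
by have := ler_distD z v x; rewrite (distrC v z) (distrC v x); lra.
Qed.

(** The radii given by [f_inv] vary with the point; compactness of [0, s], in the form of real
    induction, yields one radius along the whole lift. *)
Lemma lift_lebesgue_number y s K u c : 0 <= s <= 1 -> is_lift y s K u ->
  (forall t, 0 <= t <= s -> 0 < c < m `|u t|) ->
  exists2 r, 0 < r & forall t, 0 <= t <= s -> expanding_on_ball c (u t) r.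
Proof.
move=> /andP[s0 s1] [K0 u0 _ uK] cm.
pose P t := t <= s -> exists2 r, 0 < r &
  forall t', 0 <= t' <= t -> expanding_on_ball c (u t') r.
suff : P s by apply.
have ext t : 0 <= t <= s -> exists d r, [/\ 0 < d, 0 < r &
    forall t', 0 <= t' <= s -> `|t' - t| < d -> expanding_on_ball c (u t') r].
  move=> ts; have [r [r0 exr _]] := f_inv (cm t ts).
  have K1 : 0 < K + 1 by lra.
  (* During this time the lift moves by less than [r / 2]; [K + 1] avoids a division by 0. *)
  exists (r / 2 / (K + 1)), (r / 2); split; [by rewrite !divr_gt0|by lra|].
  move=> t' t's; rewrite ltr_pdivlMr// => tt'.
  apply: expanding_shrink exr _.
  suff : `|u t' - u t| <= `|t' - t| * (K + 1) by lra.
  have h : 0 <= `|t' - t| by [].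
  apply: (@le_trans _ _ (K * `|t' - t|)); last by lra.
  have [tt|tt] := leP t t'.
    have -> : `|t' - t| = t' - t by rewrite ger0_norm// subr_ge0.
    by apply: uK; lra.
  have -> : `|t' - t| = t - t' by rewrite ltr0_norm ?subr_lt0// opprB.
  by rewrite distrC; apply: uK; lra.
(* A radius valid near [t] and one valid up to a nearby [t1] combine into their minimum; this serves
   both induction steps. *)
have glue t d r : 0 < r ->
    (forall t', 0 <= t' <= s -> `|t' - t| < d -> expanding_on_ball c (u t') r) ->
    forall t1 t2, P t1 -> 0 <= t1 <= s -> `|t1 - t| < d ->
      `|t2 - t| < d -> P t2.
  move=> r0 rP t1 t2 Pt1 /andP[t10 t1s] t1d t2d t2s.
  have [r1 r10 r1P] := Pt1 t1s.
  exists (Num.min r r1); first by rewrite lt_min r0.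
  move=> t' /andP[t'0 t't2]; have [t't1|t1t'] := leP t' t1.
    apply: expanding_shrink (r1P t' _) _; first by rewrite t'0.
    by rewrite subrr normr0 add0r ge_min lexx orbT.
  apply: expanding_shrink (rP t' _ _) _; first by rewrite t'0 (le_trans t't2).
    move: t1d t2d; rewrite !ltr_norml; lra.
  by rewrite subrr normr0 add0r ge_min lexx.
apply: (real_induction (P := P)); last by rewrite s0.
- move=> _; have [|r [r0 rP _]] := f_inv (cm 0 _); first by rewrite lexx.
  by exists r => // t' /le_anti <-.
- move=> t /andP[t0 t1] /(_ t); rewrite t0 lexx => /(_ isT) Pt.
  have [ts|st] := leP t s; last first.
    by exists 1 => // t' /andP[tt' _] _ t's; exfalso; lra.
  have [|d [r [d0 r0 rP]]] := ext t; first by rewrite t0.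
  exists d => // t' /andP[tt' t'd] _; apply: (glue t d r r0 rP t t' Pt).
  + by rewrite t0.
  + by rewrite subrr normr0.
  + by rewrite ger0_norm; lra.
- move=> t /andP[t0 t1] Pt; have [ts|st] := leP t s; last first.
    by move=> ts; exfalso; lra.
  have [|d [r [d0 r0 rP]]] := ext t; first by rewrite ltW.
  pose t' := Num.max 0 (t - d / 2).
  have t'0 : 0 <= t' by rewrite le_max lexx.
  have t't : t' < t by rewrite gt_max t0; lra.
  have t'd : t - d / 2 <= t' by rewrite le_max lexx orbT.
  apply: (glue t d r r0 rP t' t (Pt t' _)).
  + by rewrite t'0.
  + by rewrite t'0/=; lra.
  + by rewrite distrC ger0_norm; lra.
  + by rewrite subrr normr0.
Qed.

(** While [u'] stays within [r] of [u], expansion gives [c * |u t - u' t| <= t * |y - y'| < c * (r /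
    2)], so [u'] is in fact within [r / 2] and cannot escape. The threshold [e] does not depend on
    [K']. *)
Lemma lift_stability y s K u : 0 <= s <= 1 -> is_lift y s K u ->
  exists c e, [/\ 0 < c, 0 < e & forall y' s' K' u', `|y - y'| < e ->
    s' <= s -> is_lift y' s' K' u' ->
    forall t, 0 <= t <= s' -> c * `|u t - u' t| <= t * `|y - y'|].
Proof.
move=> s01 uL; have [s0 s1] := andP s01; have [K0 u0 fu uK] := uL.
have [c0 c00 c0m] := m_low K0.
pose c := c0 / 2; have cp : 0 < c by rewrite divr_gt0.
have [|r r0 rP] := lift_lebesgue_number s01 uL (c := c).
  move=> t ts; rewrite cp/=; apply: (@lt_le_trans _ _ c0); first by rewrite /c; lra.
  apply: c0m; rewrite normr_ge0/=; apply: le_trans (is_lift_norm uL ts) _.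
  by rewrite ler_piMr//; lra.
exists c, (c * (r / 2)); split=> //; first by rewrite mulr_gt0// divr_gt0.
move=> y' s' K' u' yy' s's [K'0 u'0 fu' u'K] t /andP[t0 ts'].
pose P t := t <= s' -> c * `|u t - u' t| <= t * `|y - y'|.
suff : P t by apply.
have KK1 : 0 < K + K' + 1 by lra.
(* The two lifts need more time than [d] to drift apart by [r / 2]. *)
pose d := r / 2 / (K + K' + 1).
have d0 : 0 < d by rewrite !divr_gt0.
have step t1 t2 : P t1 -> 0 <= t1 <= t2 -> t2 < t1 + d -> P t2.
  move=> Pt1 /andP[t10 t12] t2d t2s'.
  have {}Pt1 := Pt1 (le_trans t12 t2s').
  have near1 : `|u t1 - u' t1| < r / 2.
    rewrite -(ltr_pM2l cp); apply: le_lt_trans Pt1 _; apply: le_lt_trans yy'.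
    by rewrite ler_piMl//; lra.
  have near2 : (K + K' + 1) * (t2 - t1) < r / 2.
    by rewrite mulrC -ltr_pdivlMr//; rewrite -/d; lra.
  have h1 : `|u t2 - u t1| <= K * (t2 - t1) by apply: uK; lra.
  have h2 : `|u' t2 - u' t1| <= K' * (t2 - t1) by apply: u'K; lra.
  have h3 : `|u t2 - u' t2| < r.
    have := ler_distD (u t1) (u t2) (u' t2).
    by have := ler_distD (u' t1) (u t1) (u' t2); rewrite (distrC (u' t1)); lra.
  have -> : t2 * `|y - y'| = `|f (u t2) - f (u' t2)|.
    rewrite fu ?fu'; [|by lra|by lra].
    rewrite /seg opprD addrACA subrr add0r -scalerBr opprB addrA subrK normrZ ger0_norm//.
    by lra.
  apply: (rP t2 _ (u t2) (u' t2)); first by apply/andP; split; lra.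
    exact: ballxx.
  by rewrite -ball_normE.
apply: (real_induction (P := P)); last by lra.
- by move=> _; rewrite u0 u'0 subrr normr0 mulr0 mul0r.
- move=> t1 /andP[t10 t11] /(_ t1); rewrite t10 lexx => /(_ isT) Pt1.
  by exists d => // t2 /andP[t12 t2d] _; apply: (step t1 t2 Pt1 _ t2d); lra.
- move=> t2 /andP[t20 t21] Pt.
  pose t1 := Num.max 0 (t2 - d / 2).
  have t10 : 0 <= t1 by rewrite le_max lexx.
  have t12 : t1 < t2 by rewrite gt_max t20; lra.
  have t1d : t2 - d / 2 <= t1 by rewrite le_max lexx orbT.
  by apply: (step t1 t2 (Pt t1 _)); lra.
Qed.

Lemma lift_unique y s s' K K' u u' t : 0 <= s <= 1 -> s' <= s ->
  is_lift y s K u -> is_lift y s' K' u' -> 0 <= t <= s' -> u t = u' t.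
Proof.
move=> s01 ss' uL u'L ts'.
have [c [e [c0 e0 H]]] := lift_stability s01 uL.
have := H y s' K' u'; rewrite subrr normr0 => /(_ e0 ss' u'L t ts').
rewrite mulr0 pmulr_rle0// normr_le0 subr_eq0 => /eqP; exact.
Qed.

(** Expansion at rate [c2] bounds the displacement by [L * (t - s) / c2], and the slope of [Phi] at
    [|u s|] is at most [c1 <= c2], so [Phi] of the norm grows at rate at most [L]. *)
Lemma lift_step (Phi : R -> R) (c L s : R) y u :
  (forall t s, 0 <= t <= s -> 0 <= Phi s - Phi t) ->
  (forall t, 0 <= t -> exists c d, [/\ 0 < c < m t, 0 < d &
      forall s, t <= s < t + d -> Phi s - Phi t <= c * (s - t)]) ->
  0 < c < m `|u s| -> 0 <= s <= 1 -> `|y - f 0| <= L ->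
  is_lift y s (L / c) u -> (forall t, 0 <= t <= s -> Phi `|u t| <= L * t) ->
  exists2 d, 0 < d & forall s', s < s' < s + d ->
    exists v, is_lift y s' (L / c) v /\
      forall t, 0 <= t <= s' -> Phi `|v t| <= L * t.
Proof.
move=> Phi_mono Phi_pot /andP[c0 cm] /andP[s0 s1] yL uL uPhi.
have [K0 u0 fu uK] := uL.
have L0 : 0 <= L by exact: le_trans (normr_ge0 _) yL.
set x := u s in cm *.
have [c1 [d1 [/andP[c10 c1m] d10 Phi1]]] := Phi_pot `|x| (normr_ge0 _).
(* [c] is the constant common to the whole lift and [c1] the slope of [Phi] at [|x|]; both are below
   [m |x|]. *)
pose c2 := Num.max c c1.
have cc2 : c <= c2 by rewrite le_max lexx.
have c1c2 : c1 <= c2 by rewrite le_max lexx orbT.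
have c20 : 0 < c2 by exact: lt_le_trans cc2.
have [|r [r0 rexp ropen]] := f_inv (x := x) (c := c2).
  by rewrite c20 gt_max cm c1m.
pose r1 := Num.min r d1.
have r10 : 0 < r1 by rewrite lt_min r0.
have r1r : r1 <= r by rewrite ge_min lexx.
have r1d : r1 <= d1 by rewrite ge_min lexx orbT.
have L10 : 0 < L + 1 by lra.
(* Short enough for the segment to stay where [ropen] applies and for the lift to stay where [Phi1]
   does. *)
exists (c2 * r1 / (L + 1)); first by rewrite divr_gt0// mulr_gt0.
move=> s' /andP[ss' s'd].
have fx : f x = seg y s by apply: fu; rewrite s0 lexx.
have segL t t' : t <= t' -> `|seg y t' - seg y t| <= L * (t' - t).
  move=> tt'; rewrite segB normrZ ger0_norm ?subr_ge0// mulrC.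
  by rewrite ler_wpM2r// subr_ge0.
(* The preimages are chosen independently; expansion on the ball makes [w] Lipschitz. *)
have /choice[w wP] (t : R) : exists z, s < t <= s' -> ball x r z /\ f z = seg y t.
  have [/andP[st ts']|nt] := pselect (is_true (s < t <= s')); last first.
    by exists 0 => h; case: nt.
  have [|z xz fz] := ropen (seg y t); last by exists z.
  rewrite fx distrC (le_lt_trans (segL _ _ (ltW st)))//.
  have h1 : s' - s < c2 * r1 / (L + 1) by lra.
  move: h1; rewrite ltr_pdivlMr// => h1.
  have h2 : (t - s) * (L + 1) <= (s' - s) * (L + 1) by rewrite ler_wpM2r; lra.
  have h3 : c2 * r1 <= c2 * r by rewrite ler_wpM2l// ltW.
  by rewrite mulrC; lra.
have wx t : s < t <= s' -> c2 * `|w t - x| <= L * (t - s).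
  move=> ts; have [xw fw] := wP t ts.
  apply: le_trans (rexp _ _ xw (ballxx _ r0)) _; rewrite fw fx segL//.
  by rewrite ltW// (andP ts).1.
have divc t k : c2 * `|t : X| <= L * k -> `|t| <= L / c * k.
  move=> h; rewrite mulrAC ler_pdivlMr// mulrC; apply: le_trans h.
  by rewrite ler_wpM2r.
pose v t := if t <= s then u t else w t.
exists v; split.
  split=> //.
  - by rewrite /v s0.
  - move=> t /andP[t0 ts']; rewrite /v; case: (leP t s) => [ts|st].
      by rewrite fu// t0.
    by have [|_ ->] := wP t; rewrite ?st.
  - move=> t t' /andP[t0 tt'] t's'; rewrite /v.
    have [t's|st'] := leP t' s.
      by rewrite (le_trans tt' t's); apply: uK => //; rewrite t0.
    have wx' : `|w t' - x| <= L / c * (t' - s).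
      by apply: divc; apply: wx; rewrite st'.
    have [ts|st] := leP t s.
      have : `|x - u t| <= L / c * (s - t) by apply: uK => //; rewrite t0.
      by have := ler_distD x (w t') (u t); lra.
    apply: divc.
    have [|xw fw] := wP t; first by rewrite st (le_trans tt').
    have [|xw' fw'] := wP t'; first by rewrite st'.
    by apply: le_trans (rexp _ _ xw' xw) _; rewrite fw fw' segL.
move=> t /andP[t0 ts']; rewrite /v; case: (leP t s) => [ts|st].
  by rewrite uPhi// t0.
have Phix : Phi `|x| <= L * s by apply: uPhi; rewrite s0 lexx.
have wxt : c2 * `|w t - x| <= L * (t - s) by apply: wx; rewrite st.
have [wx_le|xw_lt] := leP `|w t| `|x|.
  have : 0 <= L * (t - s) by rewrite mulr_ge0//; lra.
  by have := Phi_mono `|w t| `|x|; rewrite normr_ge0 wx_le => /(_ isT); lra.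
have wr1 : `|w t - x| < r1.
  rewrite -(ltr_pM2l c20); apply: le_lt_trans wxt _.
  have h1 : s' - s < c2 * r1 / (L + 1) by lra.
  move: h1; rewrite ltr_pdivlMr// => h1.
  have h2 : (t - s) * (L + 1) <= (s' - s) * (L + 1) by rewrite ler_wpM2r; lra.
  by rewrite mulrC; lra.
have wxd : `|w t| - `|x| <= `|w t - x| by exact: lerB_dist.
have := Phi1 `|w t|; rewrite (ltW xw_lt)/=.
have -> : `|w t| < `|x| + d1 by lra.
move=> /(_ isT).
have : c1 * (`|w t| - `|x|) <= c2 * `|w t - x|.
  by apply: ler_pM => //; lra.
lra.
Qed.

(** By uniqueness the lifts over [0, t] extend one another, so their endpoints [U t] form a
    [K]-Lipschitz curve, which converges at [s] by completeness. *)
Lemma lift_limit (Phi : R -> R) (K0 K L s : R) y :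
  (forall t s, 0 <= t <= s -> Phi s - Phi t <= K0 * (s - t)) ->
  (forall t s, 0 <= t <= s -> 0 <= Phi s - Phi t) ->
  0 <= L -> 0 < s <= 1 ->
  (forall t, 0 <= t < s -> exists v, is_lift y t K v /\
      forall t', 0 <= t' <= t -> Phi `|v t'| <= L * t') ->
  exists v, is_lift y s K v /\
      forall t, 0 <= t <= s -> Phi `|v t| <= L * t.
Proof.
move=> PhiK Phi_mono L0 /andP[s0 s1] H.
have /choice[u uP] (t : R) : exists v, 0 <= t < s -> is_lift y t K v /\
      forall t', 0 <= t' <= t -> Phi `|v t'| <= L * t'.
  have [/H[v vP]|nt] := pselect (is_true (0 <= t < s)); first by exists v.
  by exists (fun=> 0) => h; case: nt.
pose U t := u t t.
have UE t t' : 0 <= t <= t' -> t' < s -> u t' t = U t.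
  move=> /andP[t0 tt'] t's.
  have [|ut _] := uP t; first by rewrite t0 (le_lt_trans tt').
  have [|ut' _] := uP t'; first by rewrite t's (le_trans t0).
  apply: (lift_unique _ _ ut' ut) => //; last by rewrite t0 lexx.
  by rewrite (le_trans t0 tt')/=; lra.
have [|uL0 _] := uP 0; first by rewrite lexx.
have K0' : 0 <= K by case: uL0.
have UK t t' : 0 <= t <= t' -> t' < s -> `|U t' - U t| <= K * (t' - t).
  move=> tt' t's; rewrite -(UE t t')//.
  have [|[_ _ _ uK] _] := uP t'.
    by rewrite t's (le_trans (andP tt').1 (andP tt').2).
  exact: uK.
have fU t : 0 <= t < s -> f (U t) = seg y t.
  by move=> ts; have [[_ _ fu _] _] := uP t ts; rewrite fu// lexx (andP ts).1.
have nleft t : t < s -> \forall t' \near s^'-, t <= t' < s.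
  move=> ts; near=> t'; apply/andP; split; near: t'.
    exact: nbhs_left_ge.
  exact: nbhs_left_lt.
have K1 : 0 < K + 1 by lra.
have /cvg_ex[x Ux] : cvg (U @ s^'-).
  apply: cauchy_cvg; apply: cauchy_exP => e e0.
  pose t := Num.max 0 (s - e / (K + 1)).
  have t0 : 0 <= t by rewrite le_max lexx.
  have ek : 0 < e / (K + 1) by rewrite divr_gt0.
  have ts : t < s by rewrite gt_max s0; lra.
  exists (U t); apply: filterS (nleft t ts) => t' /andP[tt' t's].
  rewrite /= -ball_normE /ball_/= distrC.
  have t0t' : 0 <= t <= t' by rewrite t0.
  apply: le_lt_trans (UK t t' t0t' t's) _.
  have h : s - e / (K + 1) <= t by rewrite le_max lexx orbT.
  have : (t' - t) < e / (K + 1) by lra.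
  rewrite ltr_pdivlMr//; have : 0 <= t' - t by lra.
  by lra.
have xK t : 0 <= t < s -> `|x - U t| <= K * (s - t).
  move=> /andP[t0 ts].
  apply: (@closed_cvg _ _ s^'- _ (fun t' => `|U t' - U t|)
    (fun r : R => r <= K * (s - t))); first exact: closed_le.
    apply: filterS (nleft t ts) => t' /andP[tt' t's].
    apply: le_trans (UK t t' _ t's) _; first by rewrite t0.
    by rewrite ler_wpM2l//; lra.
  by apply: cvg_norm; apply: cvgB => //; exact: cvg_cst.
have fx : f x = seg y s.
  have h1 : f \o U @ s^'- --> f x by apply: cvg_comp Ux _; exact: fc.
  have h2 : f \o U @ s^'- --> seg y s.
    have h3 : seg y @ s^'- --> seg y s.
      apply: cvg_at_left_filter; apply: cvgD; first exact: cvg_cst.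
      by apply: cvgZl; exact: cvg_id.
    apply: cvg_trans h3; apply: near_eq_cvg.
    by apply: filterS (nleft 0 s0) => t' /fU.
  by apply: (cvg_unique _ h1 h2); exact: norm_hausdorff.
pose v t := if t < s then U t else x.
have vs t : 0 <= t <= s -> (0 <= t < s /\ v t = U t) \/ (t = s /\ v t = x).
  move=> /andP[t0]; rewrite le_eqVlt /v => /predU1P[->|ts].
    by right; rewrite ltxx.
  by left; rewrite ts t0.
exists v; split.
  split=> //.
  - by rewrite /v s0 /U; case: uL0.
  - by move=> t /vs[[/fU + ->]|[-> ->]].
  - move=> t t' /andP[t0 tt'] t's.
    have [|[/andP[_ t's'] ->]|[-> ->]] := vs t'; first by rewrite t's (le_trans t0).
      by rewrite /v (le_lt_trans tt')//; apply: UK => //; rewrite t0.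
    have [|[ts ->]|[-> ->]] := vs t; first by rewrite t0 (le_trans tt').
      exact: xK.
    by rewrite !subrr normr0 mulr0.
have PhiU t : 0 <= t < s -> Phi `|U t| <= L * t.
  by move=> ts; have [_ h] := uP t ts; apply: h; rewrite lexx (andP ts).1.
move=> t /vs[[/PhiU + ->//]|[-> ->]].
apply/ler_addgt0Pr => e e0.
have K00 : 0 <= K0.
  by have := PhiK 0 1; have := Phi_mono 0 1; rewrite lexx ler01 subr0 mulr1;
    move=> /(_ isT) h1 /(_ isT) h2; lra.
have KK : 0 < K0 * K + 1 by have : 0 <= K0 * K by [exact: mulr_ge0]; lra.
(* From [U t1] to the limit [x] the potential grows by at most [e], as [Phi] has slope at most
   [K0]. *)
pose t1 := Num.max 0 (s - e / (K0 * K + 1)).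
have ek : 0 < e / (K0 * K + 1) by rewrite divr_gt0.
have t10 : 0 <= t1 by rewrite le_max lexx.
have t1s : t1 < s by rewrite gt_max s0; lra.
have t1e : s - t1 <= e / (K0 * K + 1).
  by have : s - e / (K0 * K + 1) <= t1 by [rewrite le_max lexx orbT]; lra.
have h1 : Phi `|U t1| <= L * t1 by apply: PhiU; rewrite t10.
have h2 : `|x - U t1| <= K * (s - t1) by apply: xK; rewrite t10.
have h3 : L * t1 <= L * s by rewrite ler_wpM2l// ltW.
have h4 : K0 * `|x - U t1| <= e.
  apply: le_trans (ler_wpM2l K00 h2) _; rewrite mulrA.
  move: t1e; rewrite ler_pdivlMr//; lra.
have [xU|Ux_lt] := leP `|x| `|U t1|.
  by have := Phi_mono `|x| `|U t1|; rewrite normr_ge0 xU => /(_ isT); lra.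
have := PhiK `|U t1| `|x|; rewrite normr_ge0 ltW// => /(_ isT) h5.
have : K0 * (`|x| - `|U t1|) <= K0 * `|x - U t1|.
  by rewrite ler_wpM2l// lerB_dist.
by lra.
Unshelve. all: end_near. Qed.

(** Since [Phi |u t| <= L < Phi rho], the lift stays in the ball of radius [rho], where [m] is at
    least [c0]; hence one [c] serves at every step, and [rho] and [K] depend on [L] only. *)
Lemma lift_exists (L : R) : 0 <= L ->
  exists rho K, forall y, `|y - f 0| <= L ->
    exists u, is_lift y 1 K u /\ `|u 1| <= rho.
Proof.
move=> L0; have [Phi [rho [K0 [rho0 [Phi0 PhiK Phi_pot] LPhi]]]] := m_subpotential L.
have [c0 c00 c0m] := m_low (ltW rho0).
pose c := c0 / 2; have cp : 0 < c by rewrite divr_gt0.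
exists rho, (L / c) => y yL.
have Phi_mono t s : 0 <= t <= s -> 0 <= Phi s - Phi t by move=> /PhiK/andP[].
have PhiK0 t s : 0 <= t <= s -> Phi s - Phi t <= K0 * (s - t) by move=> /PhiK/andP[].
have bound x : Phi `|x : X| <= L -> `|x| <= rho.
  move=> xL; rewrite leNgt; apply/negP => rx.
  by have := Phi_mono rho `|x|; rewrite (ltW rho0) (ltW rx) => /(_ isT); lra.
pose P s := exists u, is_lift y s (L / c) u /\
  forall t, 0 <= t <= s -> Phi `|u t| <= L * t.
have [u [uL uPhi]] : P 1.
  apply: (real_induction (P := P)); last by rewrite lexx ler01.
  - exists (fun=> 0); split; last first.
      by move=> t /le_anti <-; rewrite normr0 Phi0 mulr0.
    split=> //; first by rewrite divr_ge0// ltW.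
      by move=> t /le_anti <-; rewrite /seg scale0r addr0.
    move=> t t' /andP[t0 tt'] _; rewrite subrr normr0 mulr_ge0 ?subr_ge0//.
    by rewrite divr_ge0// ltW.
  - move=> s /andP[s0 s1] /(_ s); rewrite s0 lexx => /(_ isT)[u [uL uPhi]].
    have cu : 0 < c < m `|u s|.
      rewrite cp/=; apply: (@lt_le_trans _ _ c0); first by rewrite /c; lra.
      apply: c0m; rewrite normr_ge0/= bound//.
      apply: le_trans (uPhi s _) _; first by rewrite s0 lexx.
      by rewrite ler_piMr// ltW.
    have s01 : 0 <= s <= 1 by rewrite s0 ltW.
    have [d d0 dP] := lift_step Phi_mono Phi_pot cu s01 yL uL uPhi.
    by exists d => // s' /dP.
  - move=> s s01 H; exact: lift_limit PhiK0 Phi_mono L0 s01 H.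
exists u; split=> //; apply: bound.
by have := uPhi 1; rewrite mulr1 lexx ler01; apply.
Qed.

Let s11 : 0 <= (1 : R) <= 1. Proof. by rewrite lexx ler01. Qed.

Lemma continuous_right_inverse : exists g : Y -> X,
  [/\ cancel g f, continuous g, g (f 0) = 0 &
    forall L, exists rho, forall y, `|y - f 0| <= L -> `|g y| <= rho].
Proof.
(* The lift is chosen for each [y] with its own constant; uniqueness later identifies it with those
   having uniform bounds. *)
have /choice[uK uKP] (y : Y) : exists uK, is_lift y 1 uK.2 uK.1.
  have [rho [K H]] := lift_exists (normr_ge0 (y - f 0)).
  by have [u [uL _]] := H y (lexx _); exists (u, K).
pose g y := (uK y).1 1.
exists g; split.
- move=> y; have [_ _ fu _] := uKP y; rewrite /g fu//.
  by rewrite /seg scale1r addrC subrK.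
- move=> y; have [c [e [c0 e0 H]]] := lift_stability s11 (uKP y).
  apply/cvgrPdist_lt => e' e'0; near=> y'.
  have yy' : `|y - y'| < e by near: y'; exact: cvgr_dist_lt.
  rewrite -(ltr_pM2l c0); apply: (@le_lt_trans _ _ `|y - y'|).
    by rewrite -[leRHS]mul1r; apply: H (uKP y') _ _ => //.
  by near: y'; apply: cvgr_dist_lt => //; rewrite mulr_gt0.
- have L0 : is_lift (f 0) 1 0 (fun=> 0).
    split=> // [t _|t t' _ _]; first by rewrite /seg subrr scaler0 addr0.
    by rewrite subrr normr0 mul0r.
  exact: (lift_unique s11 (lexx 1) (uKP (f 0)) L0 s11).
- move=> L; have [L0|L0] := leP 0 L; last first.
    exists 0 => y yL; have := le_lt_trans yL L0.
    by rewrite normr_lt0.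
  have [rho [K H]] := lift_exists L0.
  exists rho => y /H[u [uL u1]].
  by rewrite /g (lift_unique s11 (lexx 1) (uKP y) uL s11).
Unshelve. all: end_near. Qed.

(** * The two-sided inverse: coercivity and Lipschitz estimates *)

Variable g : Y -> X.
Hypotheses (gf : cancel g f) (gc : continuous g) (gf0 : g (f 0) = 0).
Hypothesis g_bounded :
  forall L, exists rho, forall y, `|y - f 0| <= L -> `|g y| <= rho.

Let half_lt x : exists2 c, 0 < c & c < m `|x : X|.
Proof.
have [c c0 cm] := m_low (normr_ge0 x); exists (c / 2); first by rewrite divr_gt0.
by have : c <= m `|x| by [apply: cm; rewrite normr_ge0 lexx]; lra.
Qed.

(* The points of the segment from 0 to [x] fixed by [g \o f] form a closed set,
   which is open because [f] is locally injective. *)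
Lemma right_inverse_cancel : cancel f g.
Proof.
move=> x; pose P (t : R) := g (f (t *: x)) = t *: x.
suff : P 1 by rewrite /P scale1r.
have linec : continuous (fun t : R => t *: x).
  by move=> t; apply: cvgZl; exact: cvg_id.
have gfc : continuous (fun t : R => g (f (t *: x))).
  move=> t; apply: (cvg_comp (fun t : R => t *: x) (g \o f) (linec t)).
  by apply: cvg_comp; [exact: fc | exact: gc].
apply: (real_induction (P := P)); last exact: s11.
- by rewrite /P scale0r.
- move=> s /andP[s0 _] /(_ s); rewrite s0 lexx => /(_ isT) Ps.
  have [c c0 cm] := half_lt (s *: x).
  have [|r [r0 rexp _]] := f_inv (x := s *: x) (c := c); first by rewrite c0.
  have /nbhs_ballP[d1 d10 d1P] := linec s _ (nbhsx_ballx (s *: x) r r0).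
  have /nbhs_ballP[d2 d20 d2P] := gfc s _ (nbhsx_ballx _ r r0).
  exists (Num.min d1 d2); first by rewrite lt_min d10.
  move=> t /andP[st]; rewrite -ltrBlDl lt_min => /andP[td1 td2] _.
  have st' : `|s - t| = t - s by rewrite ltr0_norm ?subr_lt0// opprB.
  have h1 : ball (s *: x) r (t *: x).
    by apply: d1P; rewrite -ball_normE /ball_/= st'.
  have h2 : ball (s *: x) r (g (f (t *: x))).
    by rewrite -[X in ball X]Ps; apply: d2P; rewrite -ball_normE /ball_/= st'.
  have := rexp _ _ h2 h1; rewrite gf subrr normr0 pmulr_rle0// normr_le0 subr_eq0.
  by move=> /eqP.
- move=> s /andP[s0 _] Ps; apply/eqP; rewrite -subr_eq0 -normr_le0.
  apply: (continuous_le0_left (h := fun t : R => `|g (f (t *: x)) - t *: x|)) => //.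
    by apply: cvg_norm; apply: cvgB; [exact: gfc | exact: linec].
  by move=> t ts; rewrite Ps// subrr normr0.
Qed.

Lemma inverse_coercive : norm_coercive f.
Proof.
move=> M; have [rho H] := g_bounded (M + `|f 0|).
exists rho => x; rewrite ltNge => /negP xrho; rewrite ltNge; apply/negP => fxM.
apply: xrho; rewrite -[x]right_inverse_cancel; apply: H.
by apply: le_trans (ler_normB _ _) _; rewrite lerD2r.
Qed.

Lemma inverse_local_contraction y c : 0 < c < m `|g y| ->
  exists2 d, 0 < d & forall z z', ball y d z -> ball y d z' ->
    c * `|g z - g z'| <= `|z - z'|.
Proof.
move=> /f_inv[r [r0 rexp _]].
have /nbhs_ballP[d d0 dP] := @gc y _ (nbhsx_ballx (g y) r r0).
exists d => // z z' /dP gz /dP gz'.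
by have := rexp _ _ gz gz'; rewrite !gf.
Qed.

(** [B] need not be convex, but segments between its points stay in the ball of radius [M], on whose
    image by [g] the function [m] has a positive lower bound; local contractions with one constant
    add up along the segment. *)
Lemma inverse_lipschitz (B : set Y) : bounded_set B -> [lipschitz g y | y in B].
Proof.
move=> [M0 [_ MP]]; pose M := `|M0| + 1.
have BM (y : Y) : B y -> `|y| <= M.
  by move=> By; apply: (MP M) => //; rewrite /M (le_lt_trans (ler_norm _))// ltrDl.
have [rho rhoP] := g_bounded (M + `|f 0|).
have grho (y : Y) : `|y| <= M -> `|g y| <= rho.
  by move=> yM; apply: rhoP; apply: le_trans (ler_normB _ _) _; rewrite lerD2r.
have [c0 c00 c0m] := m_low (normr_ge0 rho).
pose c := c0 / 2; have cp : 0 < c by rewrite divr_gt0.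
have key (y y' : Y) : B y -> B y' -> c * `|g y' - g y| <= `|y' - y|.
  move=> By By'; pose z (t : R) := y + t *: (y' - y).
  have zM (t : R) : 0 <= t <= 1 -> `|z t| <= M.
    move=> /andP[t0 t1]; have -> : z t = (1 - t) *: y + t *: y'.
      by rewrite /z scalerBl scale1r scalerBr addrA addrAC.
    apply: le_trans (ler_normD _ _) _; rewrite !normrZ !ger0_norm ?subr_ge0//.
    have : (1 - t) * `|y| <= (1 - t) * M by rewrite ler_wpM2l ?subr_ge0// BM.
    by have : t * `|y'| <= t * M by [rewrite ler_wpM2l// BM]; lra.
  have zc : continuous z.
    by move=> t; apply: cvgD; [exact: cvg_cst | apply: cvgZl; exact: cvg_id].
  have zB (t s : R) : z s - z t = (s - t) *: (y' - y).
    by rewrite /z opprD addrACA subrr add0r scalerBl.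
  pose P (t : R) := c * `|g (z t) - g y| - t * `|y' - y| <= 0.
  suff : P 1 by rewrite /P mul1r subr_le0 /z scale1r (addrC y) subrK.
  apply: (real_induction (P := P)); last exact: s11.
  - by rewrite /P /z scale0r addr0 subrr normr0 mulr0 mul0r subrr.
  - move=> s /andP[s0 s1] /(_ s); rewrite s0 lexx => /(_ isT) Ps.
    have [|d d0 dP] := @inverse_local_contraction (z s) c.
      rewrite cp/=; apply: (@lt_le_trans _ _ c0); first by rewrite /c; lra.
      apply: c0m; rewrite normr_ge0/=; apply: le_trans (ler_norm _).
      by apply: grho; apply: zM; rewrite s0 ltW.
    have /nbhs_ballP[d1 d10 d1P] := zc s _ (nbhsx_ballx (z s) d d0).
    exists d1 => // t /andP[st td] _; rewrite /P.
    have zt : ball (z s) d (z t).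
      by apply: d1P; rewrite -ball_normE /ball_/= distrC gtr0_norm ?subr_gt0//; lra.
    have := dP _ _ zt (ballxx _ d0); rewrite zB normrZ gtr0_norm ?subr_gt0//.
    have := ler_wpM2l (ltW cp) (ler_distD (g (z s)) (g (z t)) (g y)).
    by move: Ps; rewrite /P; lra.
  - move=> s /andP[s0 _] Ps.
    apply: (continuous_le0_left (h := fun t => c * `|g (z t) - g y| - t * `|y' - y|)) => //.
    apply: cvgB; last by apply: cvgM; [exact: cvg_id | exact: cvg_cst].
    apply: cvgM; first exact: cvg_cst.
    apply: cvg_norm; apply: cvgB; last exact: cvg_cst.
    by apply: cvg_comp; [exact: zc | exact: gc].
exists c^-1; split; first exact: num_real.
move=> K cK [y y'] /= [By By'].
have := key y' y By' By; rewrite mulrC -ler_pdivlMr// => h.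
suff : `|g y - g y'| <= K * `|y - y'| by [].
by apply: (le_trans h); rewrite mulrC ler_wpM2r// ltW.
Qed.

Lemma inverse_local_lipschitz_constant y :
  (local_lipschitz_constant g y <= ((m `|g y|)^-1)%:E)%E.
Proof.
have [c0 c00 c0m] := half_lt (g y).
have mp : 0 < m `|g y| by exact: lt_trans c0m.
apply/lee_addgt0Pr => e e0; rewrite -EFinD.
(* The [c] below [m |g y|] whose inverse exceeds the desired bound by exactly [e]. *)
pose c := (( m `|g y|)^-1 + e)^-1.
have me0 : 0 < (m `|g y|)^-1 + e by rewrite addr_gt0// invr_gt0.
have cm : 0 < c < m `|g y|.
  rewrite invr_gt0 me0/= -[ltRHS]invrK ltf_pV2 ?posrE ?invr_gt0//.
  by rewrite ltrDl.
have [d d0 dP] := inverse_local_contraction cm.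
apply: (@le_trans _ _ (ereal_sup [set (`|g p.1 - g p.2| / `|p.1 - p.2|)%:E
  | p in [set p : Y * Y | [/\ ball y d p.1, ball y d p.2 & p.1 <> p.2]]])).
  by apply: ereal_inf_lbound; exists d.
apply: ge_ereal_sup => _ [[z z'] /= [yz yz' zz'] <-].
rewrite lee_fin ler_pdivrMr; last by rewrite normr_gt0 subr_eq0; apply/eqP.
rewrite -[(_ + e)]invrK -/c mulrC ler_pdivlMr; last by case/andP: cm.
by rewrite mulrC; exact: dP.
Qed.

End global_inversion.

(** * Continuity, semicontinuity and the final assembly *)

Lemma locally_lipschitz_continuous (R : realType) (V W : normedModType R)
  (f : V -> W) : locally_lipschitz f -> continuous f.
Proof.
move=> flip x; have [U xU [M [_ MP]]] := flip x.
pose K := `|M| + 1; have K0 : 0 < K by rewrite ltr_wpDl.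
have KP : M < K by rewrite (le_lt_trans (ler_norm _))// ltrDl.
apply/cvgrPdist_lt => e e0; near=> z.
have Uz : U z by near: z.
have := MP K KP (x, z) (conj (nbhs_singleton xU) Uz).
move=> /= /le_lt_trans; apply; rewrite mulrC -ltr_pdivlMr//.
by near: z; apply: cvgr_dist_lt => //; rewrite divr_gt0.
Unshelve. all: end_near. Qed.

(** Semicontinuity is assumed on the half-line only; composing with the absolute value, which is
    1-Lipschitz, extends it to the real line, where the minorants live. *)
Lemma lower_semicontinuous_norm (R : realType) (m : R -> R) : lower_semicontinuous
    ((fun t => (m t)%:E) : subspace `[0, +oo[ -> \bar R) ->
  forall t a : R, a < m `|t| ->
    exists2 d, 0 < d & forall s, `|s - t| < d -> a < m `|s|.
Proof.
move=> mlsc t a at_; have [|V + Va] := mlsc `|t| a; first by rewrite lte_fin.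
have t0 : `[0, +oo[%classic `|t| by rewrite /= in_itv/= andbT.
rewrite [nbhs _ _](_ : _ = within `[0, +oo[%classic (nbhs `|t|) V); last first.
  by rewrite nbhs_subspace_in.
move=> -[d /= d0 dV]; exists d => // s sd.
have := Va `|s|; rewrite lte_fin; apply; apply: dV => /=.
  rewrite distrC (le_lt_trans _ sd)//; exact: ler_dist_dist.
by rewrite in_itv/= andbT.
Qed.

Theorem theorem14 (R : realType) (X Y : completeNormedModType R)
    (f : X -> Y) (Jf : X -> set (blin X Y)) (m : R -> R) :
  locally_lipschitz f ->
  pseudo_jacobian f Jf ->
  chain_rule_condition f Jf ->
  (forall x, regular_at Jf x) ->
  (forall t : R, 0 <= t -> 0 < m t) ->
  lower_semicontinuous
    ((fun t => (m t)%:E) : subspace `[0, +oo[ -> \bar R) ->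
  (\int[lebesgue_measure]_(t in `[0%R, +oo[) (m t)%:E = +oo)%E ->
  (forall x, ((m `|x|)%:E <= reg_index Jf x)%E) ->
  norm_coercive f /\
  exists g : Y -> X,
    [/\ cancel f g /\ cancel g f,
        continuous f /\ continuous g,
        forall B : set Y, bounded_set B -> [lipschitz g y | y in B] &
        forall y, (local_lipschitz_constant g y <= ((m `|g y|)^-1)%:E)%E].
Proof.
move=> flip pJ crc reg m0 mlsc moo mreg.
have fc := locally_lipschitz_continuous flip.
pose n (t : R) := m `|t|.
have n0 (t : R) : 0 < n t by exact: m0.
have n_lsc := lower_semicontinuous_norm mlsc.
have noo : (\int[lebesgue_measure]_(t in `[0%R, +oo[) (n t)%:E = +oo)%E.
  rewrite -moo; apply: eq_integral => t; rewrite inE/= in_itv/= andbT => t0.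
  by rewrite /n ger0_norm.
have f_inv (x : X) (c : R) : 0 < c < n `|x| -> exists r, [/\ 0 < r,
    expanding_on_ball f c x r &
    forall y, `|f x - y| < c * r -> exists2 z, ball x r z & f z = y].
  rewrite /n normr_id => /andP[c0 cm].
  apply: (regular_local_inversion fc pJ crc (reg x) c0).
  by apply: lt_le_trans (mreg x); rewrite lte_fin.
have n_low := lsc_segment_lower_bound n0 n_lsc.
have n_subpotential := lsc_subpotential n0 n_lsc noo.
have [g [gf gc gf0 gb]] := continuous_right_inverse fc f_inv n_low n_subpotential.
have fg := right_inverse_cancel fc f_inv n_low gf gc gf0.
split; first exact: (inverse_coercive fc f_inv n_low gf gc gf0 gb).
exists g; split=> // [B|y]; first exact: (inverse_lipschitz f_inv n_low gf gc gb).
have := inverse_local_lipschitz_constant f_inv n_low gf gc y.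
by rewrite /n normr_id.
Qed.
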